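(* Let $\xi\in\mathbb{Z}\setminus\{0\}$, let $a,b\in\mathbb{Z}$ with $b\neq 0$, and let $m\ge 3$ be an integer. Then there are $\frac{\varphi(m)}{2}$ (distinct) reduced residue classes modulo $m$, each containing infinitely many primes $p$ such that $F_p(\xi)\neq\frac{a}{b}$.
   Context: $\varphi$ is Euler's totient function ($\varphi(m)$ is even for $m\ge 3$). A reduced residue class modulo $m$ is a class $\{h+km\mid k\in\mathbb{Z}\}$ with $\gcd(h,m)=1$. For a prime $p$, $|\cdot|_p$ is the $p$-adic absolute value normalized by $|p|_p=p^{-1}$, and $\mathbb{Q}_p$ is the completion of $\mathbb{Q}$ with respect to it. For $z\in\mathbb{Q}_p$ with $|z|_p\le 1$ the series $F_p(z):=\sum_{n=0}^\infty n!\,z^n$ (Euler's factorial series) converges in $\mathbb{Q}_p$, and $F_p(z)\in\mathbb{Q}_p$ denotes its sum. *)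

(* Defs.v *)
From HB Require Import structures.
From mathcomp Require Import all_boot all_order all_algebra zify ring lra.
From mathcomp Require Import all_classical all_reals all_analysis.

Set Implicit Arguments.
Unset Strict Implicit.
Unset Printing Implicit Defensive.

Import Order.TTheory GRing.Theory Num.Theory.
Import numFieldNormedType.Exports.
Local Open Scope classical_set_scope.
Local Open Scope ring_scope.

Definition padic_val (p : nat) (x : rat) : int :=
  (logn p `|numq x|)%:Z - (logn p `|denq x|)%:Z.

(* If p is not prime then logn p is 0 and this is the trivial absolute value;
   all that follows is only of interest when p is prime. *)
Definition padic_abs (p : nat) (x : rat) : rat :=
  if x == 0 then 0 else p%:R ^ (- padic_val p x).

Section PadicAbs.
Variable p : nat.
Local Notation abs := (padic_abs p).
Local Notation val := (padic_val p).

Let q : rat := if prime p then p%:R else 1.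

Let q_ge1 : 1 <= q.
Proof. by rewrite /q; case: ifP => // /prime_gt0; rewrite ler1n. Qed.

Let q_neq0 : q != 0.
Proof. by rewrite gt_eqF // (lt_le_trans _ q_ge1). Qed.

Let logn_nonprime n : ~~ prime p -> logn p n = 0%N.
Proof. by move=> /negPf pN; rewrite lognE pN. Qed.

Let absE x : x != 0 -> abs x = q ^ (- val x).
Proof.
move=> /negPf x0; rewrite /padic_abs x0 /q; case: ifPn => // pN.
by rewrite /padic_val !logn_nonprime // subrr oppr0 !expr0z.
Qed.

Lemma padic_val_frac (a b : int) : a != 0 -> b != 0 ->
  val (a%:~R / b%:~R) = (logn p `|a|)%:Z - (logn p `|b|)%:Z.
Proof.
move=> a0 b0; set x := _ / _.
have x0 : x != 0 by rewrite mulf_neq0 ?invr_eq0 ?intr_eq0.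
have E : (numq x * b = a * denq x)%R.
  have: (numq x)%:~R * b%:~R = a%:~R * (denq x)%:~R :> rat.
    rewrite numqE mulrAC /x divfK ?intr_eq0 //.
  by rewrite -!intrM => /intr_inj.
have := congr1 (fun z => logn p `|z|) E; rewrite /= !abszM !lognM ?absz_gt0 //.
- by rewrite /padic_val; lia.
- by rewrite numq_eq0.
Qed.

Lemma padic_abs0 : abs 0 = 0.
Proof. by rewrite /padic_abs eqxx. Qed.

Lemma padic_abs_gt0 x : x != 0 -> 0 < abs x.
Proof.
by move=> x0; rewrite absE // exprz_gt0 // (lt_le_trans _ q_ge1).
Qed.

Lemma padic_abs_ge0 x : 0 <= abs x.
Proof.
have [->|/padic_abs_gt0/ltW//] := eqVneq x 0; by rewrite padic_abs0.
Qed.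

Lemma padic_abs_eq0 x : (abs x == 0) = (x == 0).
Proof.
have [->|x0] := eqVneq x 0; first by rewrite padic_abs0 eqxx.
by rewrite gt_eqF // padic_abs_gt0.
Qed.

Lemma padic_absM x y : abs (x * y) = abs x * abs y.
Proof.
have [->|x0] := eqVneq x 0; first by rewrite mul0r padic_abs0 mul0r.
have [->|y0] := eqVneq y 0; first by rewrite mulr0 padic_abs0 mulr0.
rewrite !absE ?mulf_neq0 // -expfzDr // -opprD; congr (q ^ (- _)).
have -> : x * y =
    (numq x * numq y)%:~R / (denq x * denq y)%:~R :> rat.
  by rewrite !intrM invfM mulrACA !divq_num_den.
rewrite padic_val_frac ?mulf_neq0 ?numq_eq0 // /padic_val.
by rewrite !abszM !lognM ?absz_gt0 ?numq_eq0 //; lia.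
Qed.

Lemma padic_abs1 : abs 1 = 1.
Proof. by rewrite absE // /padic_val /= logn1 subrr oppr0 expr0z. Qed.

Lemma padic_absV x : abs x^-1 = (abs x)^-1.
Proof.
have [->|x0] := eqVneq x 0; first by rewrite padic_abs0 !invr0 padic_abs0.
apply: (@mulfI _ (abs x)); first by rewrite padic_abs_eq0.
by rewrite -padic_absM !mulfV ?padic_abs_eq0 // padic_abs1.
Qed.

Lemma padic_absN x : abs (- x) = abs x.
Proof. by rewrite /padic_abs /padic_val oppr_eq0 numqN denqN abszN. Qed.

Lemma padic_abs_int (a : int) : abs a%:~R <= 1.
Proof.
have [->|a0] := eqVneq a 0; first by rewrite padic_abs0.
rewrite absE ?intr_eq0 // /padic_val numq_int denq_int logn1 subr0.
by rewrite -invr_expz invf_le1 ?exprn_gt0 ?exprn_ege1 // (lt_le_trans _ q_ge1).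
Qed.

Let abs_le1 x : abs x <= 1 -> abs (1 + x) <= 1.
Proof.
have [pP|pN] := boolP (prime p); last first.
  move=> _; have [->|x0] := eqVneq (1 + x) 0; first by rewrite padic_abs0.
  by rewrite absE // /padic_val !logn_nonprime // subrr oppr0 expr0z.
have [->|x0] := eqVneq x 0; first by rewrite addr0 padic_abs1.
have [->|x10] := eqVneq (1 + x) 0; first by rewrite padic_abs0.
have q1 : 1 < q by rewrite /q pP ltr1n prime_gt1.
rewrite !absE // -(expr0z q) !ler_eXz2l // !oppr_le0 {1}/padic_val => v.
have E1 : 1 + x = (numq x + denq x)%:~R / (denq x)%:~R.
  by rewrite intrD mulrDl mulfV ?intr_eq0 // divq_num_den addrC.
have nd0 : numq x + denq x != 0.
  apply: contra x10 => /eqP nd; rewrite E1 nd mul0r //.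
rewrite E1 padic_val_frac // subr_ge0 lez_nat.
rewrite -pfactor_dvdn ?absz_gt0 //.
change (((p ^ logn p `|denq x|)%N%:Z %| numq x + denq x)%Z).
apply: rpredD; rewrite unfold_in /= ?pfactor_dvdnn //.
by rewrite pfactor_dvdn ?absz_gt0 ?numq_eq0 //; lia.
Qed.

Lemma padic_abs_ultra x y : abs (x + y) <= Num.max (abs x) (abs y).
Proof.
wlog xy : x y / abs x <= abs y.
  move=> W; case/orP: (le_total (abs x) (abs y)) => h; first exact: W.
  by rewrite addrC maxC; exact: W.
rewrite max_r //; have [y0|y0] := eqVneq y 0.
  by move: xy; rewrite y0 padic_abs0 addr0.
have -> : x + y = y * (1 + x / y) by field.
rewrite padic_absM ger_pMr ?padic_abs_gt0 //; apply: abs_le1.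
by rewrite padic_absM padic_absV ler_pdivrMr ?padic_abs_gt0 ?mul1r.
Qed.

Lemma padic_absD x y : abs (x + y) <= abs x + abs y.
Proof.
rewrite (le_trans (padic_abs_ultra x y)) // ge_max.
by rewrite lerDl lerDr !padic_abs_ge0.
Qed.

Lemma padic_abs_distrC x y : abs (x - y) = abs (y - x).
Proof. by rewrite -padic_absN opprB. Qed.

Lemma padic_abs_dist x y : `|abs x - abs y| <= abs (x - y).
Proof.
have A u v : abs u - abs v <= abs (u - v).
  by rewrite lerBlDr (le_trans _ (padic_absD _ _)) // subrK.
by rewrite ler_norml A andbT lerNl opprB padic_abs_distrC A.
Qed.

Lemma padic_abs_close x y : abs (x - y) < abs y -> abs x = abs y.
Proof.
move=> xy; apply/eqP; rewrite eq_le; apply/andP; split.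
  by rewrite -[x](subrK y) (le_trans (padic_abs_ultra _ _)) // max_r // ltW.
rewrite leNgt; apply/negP => yx; have := padic_abs_ultra (y - x) x.
by rewrite subrK padic_abs_distrC leNgt gt_max xy yx.
Qed.

End PadicAbs.

Definition padic_cauchy (p : nat) : {pred nat -> rat} := fun s =>
  `[< forall e, 0 < e -> exists N, forall m n, (N <= m)%N -> (N <= n)%N ->
        padic_abs p (s m - s n) < e >].

Lemma padic_cauchy_bounded p s : s \in padic_cauchy p ->
  exists2 M, 0 < M & forall n, padic_abs p (s n) <= M.
Proof.
move=> /asboolP /(_ 1 ltr01) [N sN].
exists (\sum_(i < N.+1) padic_abs p (s i) + 1) => [|n].
  by rewrite ltr_wpDl // sumr_ge0 // => i _; exact: padic_abs_ge0.
have [nN|Nn] := leqP n N.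
  rewrite (bigD1 (Ordinal (nN : (n < N.+1)%N))) //= -addrA lerDl addr_ge0 //.
  by rewrite sumr_ge0 // => i _; exact: padic_abs_ge0.
rewrite big_ord_recr /= -addrA -[leLHS]add0r lerD //.
  by rewrite sumr_ge0 // => i _; exact: padic_abs_ge0.
have h : padic_abs p (s n - s N) < 1 by rewrite sN // ltnW.
rewrite -[s n](subrK (s N)) (le_trans (padic_absD _ _ _)) //.
by rewrite [leRHS]addrC lerD // ltW.
Qed.

Lemma padic_cauchy_subring p : subring_closed (padic_cauchy p).
Proof.
split.
- by apply/asboolP => e e0; exists 0%N => m n _ _; rewrite subrr padic_abs0.
- move=> s t /asboolP sC /asboolP tC; apply/asboolP => e e0.
  have e20 : 0 < e / 2 by rewrite divr_gt0.
  have [N1 H1] := sC _ e20; have [N2 H2] := tC _ e20.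
  exists (maxn N1 N2) => m n; rewrite !geq_max => /andP[m1 m2] /andP[n1 n2].
  have -> : (s - t) m - (s - t) n = (s m - s n) + (t n - t m).
    by rewrite -[(s - t) m]/(s m - t m) -[(s - t) n]/(s n - t n); ring.
  rewrite (le_lt_trans (padic_absD _ _ _)) // [e]splitr ltrD //.
  + exact: H1.
  + exact: H2.
- move=> s t sC tC.
  have [A A0 sA] := padic_cauchy_bounded sC.
  have [B B0 tB] := padic_cauchy_bounded tC.
  move: sC tC => /asboolP sC /asboolP tC; apply/asboolP => e e0.
  have e1 : 0 < e / 2 / B by rewrite !divr_gt0.
  have e2 : 0 < e / 2 / A by rewrite !divr_gt0.
  have [N1 H1] := sC _ e1; have [N2 H2] := tC _ e2.
  exists (maxn N1 N2) => m n; rewrite !geq_max => /andP[m1 m2] /andP[n1 n2].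
  have -> : (s * t) m - (s * t) n = (s m - s n) * t m + s n * (t m - t n).
    by rewrite -[(s * t) m]/(s m * t m) -[(s * t) n]/(s n * t n); ring.
  rewrite (le_lt_trans (padic_absD _ _ _)) // [e]splitr !padic_absM.
  have h1 := H1 _ _ m1 n1; have h2 := H2 _ _ m2 n2.
  rewrite ltr_pdivlMr // in h1; rewrite ltr_pdivlMr // in h2; apply: ltrD.
  + by apply: le_lt_trans h1; rewrite ler_wpM2l // padic_abs_ge0.
  + apply: le_lt_trans h2; rewrite mulrC ler_wpM2l // padic_abs_ge0 //.
Qed.

HB.instance Definition _ p := GRing.isSubringClosed.Build _ (padic_cauchy p)
  (padic_cauchy_subring p).

Record cauchy_ring (p : nat) := CauchySeq {
  cauchy_seq :> nat -> rat;
  _ : cauchy_seq \in padic_cauchy p }.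

HB.instance Definition _ p := [isSub for @cauchy_seq p].
HB.instance Definition _ p := [Choice of cauchy_ring p by <:].
HB.instance Definition _ p :=
  [SubChoice_isSubComNzRing of cauchy_ring p by <:].

Definition padic_null (p : nat) : {pred cauchy_ring p} := fun s =>
  `[< forall e, 0 < e -> exists N, forall n, (N <= n)%N ->
        padic_abs p (s n) < e >].
Arguments padic_null : clear implicits.

Lemma cauchy_ring_eventually p (s : cauchy_ring p) :
  s \notin padic_null p -> exists r N, 0 < r /\
    forall n, (N <= n)%N -> padic_abs p (s n) = r.
Proof.
move=> /asboolPn/existsNP[e /not_implyP[e0 /forallNP sN]].
have /asboolP/(_ _ e0)[N HN] := valP s.
have /existsNP[k /not_implyP[Nk /negP]] := sN N; rewrite -leNgt => ek.
exists (padic_abs p (s k)), N; split=> [|n Nn]; first exact: lt_le_trans ek.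
by apply: padic_abs_close; exact: lt_le_trans (HN _ _ Nn Nk) ek.
Qed.

Lemma padic_null_ideal p : idealr_closed (padic_null p).
Proof.
split.
- by apply/asboolP => e e0; exists 0%N => n _; rewrite padic_abs0.
- apply/asboolPn => /(_ 1 ltr01)[N /(_ N (leqnn _))].
  by rewrite padic_abs1 ltxx.
move=> a s t /asboolP sN /asboolP tN; apply/asboolP => e e0.
have [A A0 aA] := padic_cauchy_bounded (valP a).
have e1 : 0 < e / 2 / A by rewrite !divr_gt0.
have e2 : 0 < e / 2 by rewrite divr_gt0.
have [N1 H1] := sN _ e1; have [N2 H2] := tN _ e2.
exists (maxn N1 N2) => n; rewrite geq_max => /andP[n1 n2].
rewrite -[(a * s + t) n]/(a n * s n + t n) (le_lt_trans (padic_absD _ _ _)) //.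
rewrite [e]splitr ltrD ?H2 // padic_absM.
have := H1 _ n1; rewrite ltr_pdivlMr //; apply: le_lt_trans.
rewrite mulrC ler_wpM2l ?padic_abs_ge0 //; exact: aA.
Qed.

HB.instance Definition _ p := isIdealr.Build _ (padic_null p)
  (padic_null_ideal p).

Definition Qp (p : nat) := {ideal_quot (padic_null p)}.

HB.instance Definition _ p := GRing.ComNzRing.on (Qp p).

Definition Qp_inv p (x : Qp p) : Qp p := xget 0 [set y | y * x = 1].

Lemma Qp_mulVf p (x : Qp p) : x != 0 -> Qp_inv x * x = 1.
Proof.
move=> x0; suff [y yx] : exists y : Qp p, y * x = 1.
  exact: (xgetPex 0 (ex_intro [set y : Qp p | y * x = 1] y yx)).
elim/quotW: x x0 => s; rewrite -[0](rmorph0 \pi_(Qp p)%qT).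
rewrite -Quotient.idealrBE subr0 => /cauchy_ring_eventually[r [N [r0 sN]]].
have sn0 n : (N <= n)%N -> s n != 0.
  by move=> /sN sr; rewrite -(padic_abs_eq0 p) sr gt_eqF.
have tC : (fun n => (s n)^-1) \in padic_cauchy p.
  apply/asboolP => e e0.
  have /asboolP/(_ (e * r * r))[|M HM] := valP s; first by rewrite !mulr_gt0.
  exists (maxn N M) => m n; rewrite !geq_max => /andP[m1 m2] /andP[n1 n2].
  have -> : (s m)^-1 - (s n)^-1 = (s n - s m) / s m / s n.
    by field; rewrite !sn0.
  rewrite !padic_absM !padic_absV !sN // !ltr_pdivrMr //.
  exact: HM.
exists (\pi_(Qp p)%qT (CauchySeq tC)).
rewrite -rmorphM -(rmorph1 \pi_(Qp p)%qT); apply/eqP.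
rewrite -Quotient.idealrBE; apply/asboolP => e e0; exists N => n Nn.
change (padic_abs p ((s n)^-1 * s n - 1) < e); rewrite mulVf ?sn0 // subrr.
Qed.

Lemma Qp_inv0 p : Qp_inv (0 : Qp p) = 0.
Proof.
by apply: xgetPN => y /= /eqP; rewrite mulr0 eq_sym oner_eq0.
Qed.

HB.instance Definition _ p :=
  GRing.ComNzRing_isField.Build (Qp p) (@Qp_mulVf p) (@Qp_inv0 p).

(* The extension of the absolute value by continuity, along the Cauchy
   sequence of rationals representing x. Its values are rational, being 0 or
   a power of p. *)
Definition Qp_norm p (x : Qp p) : rat :=
  limn ((fun n => padic_abs p (repr x n)) : nat -> rat^o).

Lemma cauchy_ring_abs_cvg p (s : cauchy_ring p) :
  cvgn ((fun n => padic_abs p (s n)) : nat -> rat^o).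
Proof.
have [/asboolP s0|/cauchy_ring_eventually[r [N [_ sN]]]] :=
  boolP (s \in padic_null p).
  apply/cvg_ex; exists 0; apply/cvgrPdist_lt => e e0.
  have [N sN] := s0 _ e0; exists N => // n /= Nn.
  by rewrite sub0r normrN ger0_norm ?padic_abs_ge0 // sN.
apply/cvg_ex; exists r; apply/cvgrPdist_lt => e e0.
by exists N => // n /= Nn; rewrite sN // subrr normr0.
Qed.

Lemma Qp_norm_pi p (s : cauchy_ring p) (r : rat) :
  ((fun n => padic_abs p (s n)) : nat -> rat^o) @ \oo --> (r : rat^o) ->
  Qp_norm (\pi_(Qp p)%qT s) = r.
Proof.
move=> sr; apply: (@cvg_lim rat^o); first exact: norm_hausdorff.
apply/cvgrPdist_lt => e e0.
have e20 : 0 < e / 2 by rewrite divr_gt0.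
have [N _ HN] := iffLR (cvgrPdist_lt _ _) sr _ e20.
have : s == repr (\pi_(Qp p)%qT s) %[mod Qp p]%qT by rewrite reprK.
rewrite -Quotient.idealrBE => /asboolP/(_ _ e20)[M HM].
exists (maxn N M) => // n; rewrite /= geq_max => /andP[n1 n2].
rewrite -[r](subrK (padic_abs p (s n))) -addrA [e]splitr.
rewrite (le_lt_trans (ler_normD _ _)) // ltrD ?HN //.
rewrite (le_lt_trans (padic_abs_dist _ _ _)) //; exact: HM.
Qed.

Lemma Qp_norm_cvg p (s : cauchy_ring p) :
  ((fun n => padic_abs p (s n)) : nat -> rat^o) @ \oo -->
  (Qp_norm (\pi_(Qp p)%qT s) : rat^o).
Proof.
have /cvg_ex[r sr] := @cauchy_ring_abs_cvg p s.
by rewrite (Qp_norm_pi sr).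
Qed.
Arguments Qp_norm_cvg {p} s.

Lemma Qp_norm_ge0 p (x : Qp p) : 0 <= Qp_norm x.
Proof.
elim/quotW: x => s; apply: (ler_cvg_to (cvg_cst (0 : rat^o)) (Qp_norm_cvg s)).
by near=> n; exact: padic_abs_ge0.
Unshelve. all: by end_near. Qed.

Lemma Qp_norm_eq0 p (x : Qp p) : Qp_norm x = 0 -> x = 0.
Proof.
elim/quotW: x => s s0; apply/eqP; rewrite -(rmorph0 \pi_(Qp p)%qT).
rewrite -Quotient.idealrBE subr0; apply/asboolP => e e0.
have := Qp_norm_cvg s; rewrite s0 => s1.
have [N _ HN] := iffLR (cvgrPdist_lt _ _) s1 _ e0.
exists N => n Nn; have := HN n Nn.
by rewrite sub0r normrN ger0_norm ?padic_abs_ge0.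
Qed.

Lemma Qp_normN p (x : Qp p) : Qp_norm (- x) = Qp_norm x.
Proof.
elim/quotW: x => s; rewrite -rmorphN; apply: Qp_norm_pi.
have -> : (fun n => padic_abs p ((- s) n)) = (fun n => padic_abs p (s n)).
  by apply/funext => n; exact: padic_absN.
exact: Qp_norm_cvg.
Qed.

Lemma Qp_normM p (x y : Qp p) : Qp_norm (x * y) = Qp_norm x * Qp_norm y.
Proof.
elim/quotW: x => s; elim/quotW: y => t; rewrite -rmorphM; apply: Qp_norm_pi.
have -> : (fun n => padic_abs p ((s * t) n)) =
    (fun n => padic_abs p (s n) * padic_abs p (t n)).
  by apply/funext => n; exact: padic_absM.
exact: (@cvgM rat _ _ _ _ _ _ _ (Qp_norm_cvg s) (Qp_norm_cvg t)).
Qed.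

Lemma Qp_normD p (x y : Qp p) : Qp_norm (x + y) <= Qp_norm x + Qp_norm y.
Proof.
elim/quotW: x => s; elim/quotW: y => t; rewrite -rmorphD.
apply: (ler_cvg_to (Qp_norm_cvg _)
  (@cvgD rat rat^o _ _ _ _ _ _ _ (Qp_norm_cvg s) (Qp_norm_cvg t))).
by near=> n; exact: padic_absD.
Unshelve. all: by end_near. Qed.

Lemma Qp_norm0 p : Qp_norm (0 : Qp p) = 0.
Proof.
rewrite -(rmorph0 \pi_(Qp p)%qT); apply: Qp_norm_pi.
have -> : (fun n => padic_abs p ((0 : cauchy_ring p) n)) = (fun=> 0).
  by apply/funext => n; exact: padic_abs0.
exact: cvg_cst.
Qed.

Lemma Qp_normBC p (x y : Qp p) : Qp_norm (x - y) = Qp_norm (y - x).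
Proof. by rewrite -Qp_normN opprB. Qed.

Definition Qp_dist p (x y : Qp p) := Qp_norm (x - y).

Lemma Qp_distxx p (x : Qp p) : Qp_dist x x = 0.
Proof. by rewrite /Qp_dist subrr Qp_norm0. Qed.

Lemma Qp_dist_eq0 p (x y : Qp p) : Qp_dist x y = 0 -> x = y.
Proof. by move=> /Qp_norm_eq0/eqP; rewrite subr_eq0 => /eqP. Qed.

Lemma Qp_distC p (x y : Qp p) : Qp_dist x y = Qp_dist y x.
Proof. exact: Qp_normBC. Qed.

Lemma Qp_dist_triangle p (y x z : Qp p) :
  Qp_dist x z <= Qp_dist x y + Qp_dist y z.
Proof. by rewrite /Qp_dist -[x - z](subrKA y) Qp_normD. Qed.

HB.instance Definition _ p := isMetric.Build rat (Qp p) (@Qp_distxx p)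
  (@Qp_dist_eq0 p) (@Qp_distC p) (@Qp_dist_triangle p).
HB.instance Definition _ p := isPointed.Build (Qp p) 0.

(* Qp p is indeed the completion: it is complete, and the rationals are a dense subfield on
   which the norm is the p-adic absolute value. *)
Section Completion.
Variable p : nat.

Let cst_cauchy (r : rat) : (fun=> r) \in padic_cauchy p.
Proof.
by apply/asboolP => e e0; exists 0%N => m n _ _; rewrite subrr padic_abs0.
Qed.

Let cst (r : rat) : Qp p := \pi_(Qp p)%qT (CauchySeq (cst_cauchy r)).

Let cstB r s : cst (r - s) = cst r - cst s.
Proof. by rewrite /cst -rmorphB; congr (\pi_(Qp p)%qT _); apply/val_inj. Qed.

Let cstM r s : cst (r * s) = cst r * cst s.
Proof. by rewrite /cst -rmorphM; congr (\pi_(Qp p)%qT _); apply/val_inj. Qed.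

Let cst1 : cst 1 = 1.
Proof.
by rewrite /cst -(rmorph1 \pi_(Qp p)%qT); congr (\pi_(Qp p)%qT _); apply/val_inj.
Qed.

Let norm_cst r : Qp_norm (cst r) = padic_abs p r.
Proof. by apply: Qp_norm_pi; apply: (@cvg_cst rat^o (padic_abs p r) nat \oo). Qed.

Let cst_ratr r : cst r = ratr r.
Proof.
have cstint (z : int) : cst z%:~R = z%:~R.
  have c0 : cst 0 = 0 by rewrite -(subrr 0) cstB subrr.
  have cN x : cst (- x) = - cst x by rewrite -sub0r cstB c0 sub0r.
  have cn n : cst n%:R = n%:R.
    elim: n => // n IHn.
    by rewrite -[n.+1]addn1 !natrD -[X in cst (_ + X)]opprK cstB cN cst1 opprK IHn.
  by case: z => n; rewrite ?NegzE ?mulrNz ?cN -!pmulrn cn.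
have d0 : cst (denq r)%:~R != 0.
  apply/eqP => /(congr1 (@Qp_norm p)); rewrite norm_cst Qp_norm0 => /eqP.
  by rewrite padic_abs_eq0 intr_eq0 denq_eq0.
rewrite /ratr -!cstint; apply: (mulIf d0).
by rewrite divfK // -cstM -numqE.
Qed.

Lemma Qp_norm_ratr (r : rat) : Qp_norm (ratr r : Qp p) = padic_abs p r.
Proof. by rewrite -cst_ratr norm_cst. Qed.

Lemma ratr_Qp_inj : injective (ratr : rat -> Qp p).
Proof.
move=> r s /eqP; rewrite -subr_eq0 -!cst_ratr -cstB => /eqP rs.
have := norm_cst (r - s); rewrite rs Qp_norm0 => /esym/eqP.
by rewrite padic_abs_eq0 subr_eq0 => /eqP.
Qed.

Lemma ratr_Qp_dense (x : Qp p) (e : rat) : 0 < e ->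
  exists r : rat, Qp_norm (x - ratr r) < e.
Proof.
elim/quotW: x => s e0; have e20 : 0 < e / 2 by rewrite divr_gt0.
have /asboolP/(_ _ e20)[N HN] := valP s; exists (s N).
rewrite -cst_ratr -rmorphB; apply: (@le_lt_trans _ _ (e / 2)).
  apply: (ler_cvg_to (Qp_norm_cvg _) (cvg_cst (e / 2 : rat^o))).
  by exists N => // n Nn; apply/ltW/HN.
by rewrite ltr_pdivrMr // mulr_natr mulr2n ltrDl.
Qed.

Lemma Qp_cauchy_cvg (F : set_system (Qp p)) :
  ProperFilter F -> cauchy F -> cvg F.
Proof.
move=> FF /cauchyP Fc.
have /choice[r Fr] (k : nat) :
    exists r : rat, F [set x | Qp_norm (x - ratr r) < k.+1%:R^-1].
  have k0 : 0 < k.+1%:R^-1 / 2 :> rat by rewrite divr_gt0.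
  have [x Fx] := Fc _ k0; have [r xr] := ratr_Qp_dense x k0.
  exists r; apply: filterS Fx => y.
  rewrite ballEmdist /= => xy; rewrite -(subrKA x) [ltRHS]splitr.
  by rewrite (le_lt_trans (Qp_normD _ _)) // ltrD // Qp_normBC.
have rP j k : padic_abs p (r j - r k) < j.+1%:R^-1 + k.+1%:R^-1.
  have [x [/= xj xk]] := filter_ex (filterI (Fr j) (Fr k)).
  rewrite -norm_cst cstB !cst_ratr -(subrKA x).
  by rewrite (le_lt_trans (Qp_normD _ _)) // ltrD // Qp_normBC.
have small (e : rat) : 0 < e -> exists N, forall n, (N <= n)%N -> n.+1%:R^-1 < e.
  move=> e0; exists (Num.truncn e^-1) => n Nn.
  rewrite invf_plt ?posrE // (lt_le_trans (truncnS_gt _)) //.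
  by rewrite ler_nat.
have rC : r \in padic_cauchy p.
  apply/asboolP => e e0; have [|N HN] := small (e / 2); first by rewrite divr_gt0.
  exists N => m n Nm Nn; rewrite (lt_trans (rP _ _)) // [ltRHS]splitr.
  by rewrite ltrD // HN.
pose x : Qp p := \pi_(Qp p)%qT (CauchySeq rC).
have xr k : Qp_norm (x - ratr (r k)) <= k.+1%:R^-1.
  rewrite -cst_ratr -rmorphB; apply/ler_addgt0Pr => e e0.
  have [N HN] := small _ e0.
  apply: (ler_cvg_to (Qp_norm_cvg _) (cvg_cst (k.+1%:R^-1 + e : rat^o))).
  exists N => // n Nn; rewrite ltW // (lt_trans (rP n k)) // addrC ltrD2l.
  exact: HN.
apply/cvg_ex; exists x; apply/metricType_numDomainType.fcvgrPdist_lt => e e0.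
have [|N HN] := small (e / 2); first by rewrite divr_gt0.
apply: filterS (Fr N) => y /= yN.
rewrite /mdist /= /Qp_dist -(subrKA (ratr (r N))) [e]splitr.
rewrite (le_lt_trans (Qp_normD _ _)) // ler_ltD //.
  by rewrite (le_trans (xr N)) // ltW // HN.
by rewrite Qp_normBC (lt_trans yN) // HN.
Qed.

End Completion.

HB.instance Definition _ p := Uniform_isComplete.Build (Qp p) (@Qp_cauchy_cvg p).

(* For p prime, the series converges when Qp_norm z <= 1; otherwise limn
   returns a junk value. *)
Definition euler_series p (z : Qp p) : Qp p :=
  limn (series (fun n => n`!%:R * z ^+ n)).

Definition residue_class (m : nat) (h : int) : set int :=
  range (fun k : int => h + k * m%:Z).

Definition reduced_residue_class (m : nat) (C : set int) : Prop :=
  exists2 h : int, coprimez h m%:Z & C = residue_class m h.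

(* Main.v *)
(* If F_p(xi) = a/b for almost all primes p in a set B of more than half of the
   reduced classes, let P_n/Q_n be the diagonal Pade approximants of
   sum_k k! z^k at xi. For every p at once Q_n F_p(xi) - P_n is divisible by
   n!^2, so the integer a Q_n - b P_n, of size C^n n!, is divisible by the part
   of n!^2 supported on the primes of B. Its logarithm is about
   2 (#B / phi(m)) n ln n > n ln n, so a Q_n - b P_n = 0; this fails for n or
   for n + 1 because of the determinant Q_n P_(n+1) - Q_(n+1) P_n.

   The weight of the primes of B comes from Dirichlet's theorem, obtained here
   without complex characters. Along an ultrafilter, sigma(f) is the limit of
   (1/ln n) sum_(d <= n) f(d) Lambda(d)/d. The operator (A f)(g) = sigma(f(g .))
   satisfies A^2 = -A on the functions with bounded partial sums: A f has
   vanishing sums sum_k (A f)(g k)/k because sum f(n) ln n / n is bounded, and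
   Moebius inversion gives A = -1 on the functions with vanishing sums. If sigma
   were not uniform on the reduced classes, a nonzero A f normalized at a maximum
   of its absolute value would be a real character chi with L(1, chi) = 0, which
   is excluded by Monsky's argument on sum_n chi(n) t^n / (1 - t^n). *)

Require Import Defs.
From mathcomp Require Import all_boot all_order all_algebra zify ring lra.
From mathcomp Require Import all_classical all_reals all_analysis Rstruct.
Set Implicit Arguments.
Unset Strict Implicit.
Unset Printing Implicit Defensive.
Import Order.TTheory GRing.Theory Num.Theory.
Import numFieldNormedType.Exports.
Local Open Scope classical_set_scope.
Local Open Scope ring_scope.

(** * Pade approximants of the factorial series *)

(** On a nonprincipal character chi modulo m one has (A chi)(g) = sigma(chi) chi(g), and sigma(chi)
    is 0 or -1 according as L(1, chi) is nonzero or zero. So A is minus the projection onto the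
    characters with L(1, chi) = 0, and A^2 = -A expresses this without naming characters. Complex
    characters need no separate treatment: at a maximum of the absolute value of A f, positivity of
    the densities leaves only the values 0, 1 and -1. The ultrafilter is there because the existence
    of densities is not known beforehand: along it every bounded function has one, and linearity and
    order survive. Nothing is lost, since the final contradiction needs a single large n and every
    set of the ultrafilter meets every tail. More than half of the classes means at least (phi(m) +
    1)/2 of them, so the main term wins by a positive multiple of n ln n while all other terms are
    O(n). Hence crude estimates suffice: Chebyshev's bound with constant 4, Mertens' theorem up to a
    bounded error, Stirling's formula up to O(n). *)

Lemma fact_dvd m n : (m <= n)%N -> (m`! %| n`!)%N.
Proof. by move=> mn; rewrite -(bin_fact mn) dvdn_mull // dvdn_mulr. Qed.

Section Pade.
Variable z : int.

Fixpoint laguerre_rec (u v : int) (n : nat) : int * int :=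
  if n is n'.+1 then
    let w := laguerre_rec u v n' in
    (w.2, (1 - (2 * n' + 3)%:R * z) * w.2 - (n'.+1 ^ 2)%:R * z ^+ 2 * w.1)
  else (u, v).

(* The three-term recurrence of the monic Laguerre polynomials L_n, read on
   Q_n(z) = z^n L_n(1/z). *)
Definition padeQ n := (laguerre_rec 1 (1 - z) n).1.
Definition padeP n := (laguerre_rec 0 1 n).1.

Lemma padeQ_rec n : padeQ n.+2 =
  (1 - (2 * n + 3)%:R * z) * padeQ n.+1 - (n.+1 ^ 2)%:R * z ^+ 2 * padeQ n.
Proof. by []. Qed.

Lemma padeP_rec n : padeP n.+2 =
  (1 - (2 * n + 3)%:R * z) * padeP n.+1 - (n.+1 ^ 2)%:R * z ^+ 2 * padeP n.
Proof. by []. Qed.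

(** A Casoratian: the middle coefficient of the recurrence cancels, and each step multiplies by the
    last one. For [z != 0] it is nonzero, which keeps two consecutive linear forms from vanishing
    together. *)
Lemma pade_det n : padeQ n * padeP n.+1 - padeQ n.+1 * padeP n =
  (n`! ^ 2)%:R * z ^+ (2 * n).
Proof.
elim: n => [|n IHn]; first by rewrite /padeQ /padeP /= fact0 muln0 expr0; ring.
have -> : padeQ n.+1 * padeP n.+2 - padeQ n.+2 * padeP n.+1 =
  (n.+1 ^ 2)%:R * z ^+ 2 * (padeQ n * padeP n.+1 - padeQ n.+1 * padeP n).
  by rewrite padeQ_rec padeP_rec; ring.
by rewrite IHn factS expnMn natrM mulnS exprD; ring.
Qed.

Lemma laguerre_rec_bound u v n : z != 0 -> `|u| <= 1 -> `|v| <= 4 * `|z| ->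
  `|(laguerre_rec u v n).1| <= (4 * `|z|) ^+ n * n`!%:R.
Proof.
move=> z0 hu hv; have Z1 : 1 <= `|z| by rewrite -gtz0_ge1 normr_gt0.
set Z := `|z| in hv Z1 *.
have {hu hv}: `|(laguerre_rec u v n).1| <= (4 * Z) ^+ n * n`!%:R /\
   `|(laguerre_rec u v n).2| <= (4 * Z) ^+ n.+1 * n.+1`!%:R; last by case.
elim: n => [|n [IH1 IH2]]; first by rewrite /= !expr0 expr1 !fact0 !mulr1.
split; first exact: IH2.
rewrite /=; move: IH1 IH2; move: (laguerre_rec u v n) => [x y] /= hx hy.
apply: le_trans (ler_normB _ _) _; rewrite !normrM.
have h1 : `|1 - (2 * n + 3)%:R * z| <= (2 * n + 4)%:R * Z.
  apply: le_trans (ler_normB _ _) _.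
  rewrite normr1 normrM normr_nat -/Z [(2 * n + 4)%:R]natrD [(2 * n + 3)%:R]natrD.
  lia.
rewrite normr_nat -/Z.
apply: (@le_trans _ _ ((2 * n + 4)%:R * Z * ((4 * Z) ^+ n.+1 * (n.+1)`!%:R) +
  (n.+1 ^ 2)%:R * Z ^+ 2 * ((4 * Z) ^+ n * n`!%:R))).
  by apply: lerD; [apply: ler_pM|apply: ler_wpM2l => //; rewrite mulr_ge0].
(* [T] is the common factor: the triangle inequality yields [(9 * n + 17) * T], the target is
   [(16 * n + 32) * T]. *)
set T := (4 * Z) ^+ n * n`!%:R * n.+1%:R * Z ^+ 2.
have T0 : 0 <= T by rewrite /T !mulr_ge0 ?exprn_ge0 //; lia.
have -> : (4 * Z) ^+ n.+2 * n.+2`!%:R = (16 * n + 32)%:R * T.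
  by rewrite /T !factS !natrM natrD natrM !exprS -[n.+2]addn1 -[n.+1]addn1 !natrD; ring.
have -> : (2 * n + 4)%:R * Z * ((4 * Z) ^+ n.+1 * (n.+1)`!%:R) +
  (n.+1 ^ 2)%:R * Z ^+ 2 * ((4 * Z) ^+ n * n`!%:R) = (9 * n + 17)%:R * T.
  rewrite /T !factS !natrM !natrD ?natrM !exprS -[n.+1]addn1 ?natrD ?natrM. by ring.
by rewrite ler_wpM2r // ler_nat; lia.
Qed.

Lemma padeQ_bound n : z != 0 -> `|padeQ n| <= (4 * `|z|) ^+ n * n`!%:R.
Proof.
move=> z0; apply: laguerre_rec_bound => //.
have Z1 : 1 <= `|z| by rewrite -gtz0_ge1 normr_gt0.
by apply: le_trans (ler_normB _ _) _; rewrite normr1; lia.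
Qed.

Lemma padeP_bound n : z != 0 -> `|padeP n| <= (4 * `|z|) ^+ n * n`!%:R.
Proof.
move=> z0; apply: laguerre_rec_bound => //.
have Z1 : 1 <= `|z| by rewrite -gtz0_ge1 normr_gt0.
by rewrite normr1; lia.
Qed.

Definition euler_sum K : int := \sum_(k < K) k`!%:R * z ^+ k.

(* As a power series Q_n(z) F(z) - P_n(z) is the sum over all k. Truncating F
   at K changes it only by a multiple of K!. *)
Definition pade_rem n K : int :=
  \sum_(k < K) (n`! * k`! * 'C(k, n))%:R * z ^+ (n + k).

(** In the powers of [z] only the summand [1 * pade_rem n.+1 K] is out of step with the others, by
    one. Matching its term [k.+1] with their term [k] leaves a boundary term at [K], a multiple of
    [K!]. *)
Lemma pade_rem_rec n K : pade_rem n.+2 K =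
  (1 - (2 * n + 3)%:R * z) * pade_rem n.+1 K - (n.+1 ^ 2)%:R * z ^+ 2 * pade_rem n K
  + (n.+1`! * K`! * 'C(K, n.+1))%:R * z ^+ (n.+1 + K).
Proof.
elim: K => [|K IHK].
  by rewrite /pade_rem !big_ord0 bin0n muln0 !mulr0 mul0r subr0 addr0.
rewrite /pade_rem !big_ord_recr /= -!/(pade_rem _ K) IHK.
(* The identity between coefficients, a consequence of Pascal's rule and [mul_bin_left]. The case
   [K <= n] is split off because subtraction truncates. *)
have h : ((n.+2`! * K`! * 'C(K, n.+2)) + (n.+1`! * K`! * 'C(K, n.+1)) * (2 * n + 3)
   + n.+1 ^ 2 * (n`! * K`! * 'C(K, n)) = n.+1`! * K.+1`! * 'C(K.+1, n.+1))%N.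
  have e1 : (n.+2 * 'C(K, n.+2) = (K - n.+1) * 'C(K, n.+1))%N by rewrite mul_bin_left.
  have e2 : (n.+1 * 'C(K, n.+1) = (K - n) * 'C(K, n))%N by rewrite mul_bin_left.
  rewrite binS !factS.
  have -> : (n.+2 * (n.+1 * n`!) * K`! * 'C(K, n.+2) =
     n.+1 * n`! * K`! * (n.+2 * 'C(K, n.+2)))%N by lia.
  rewrite e1.
  have [nK|Kn] := ltnP n K; last first.
    have -> : 'C(K, n.+1) = 0%N by rewrite bin_small.
    have [nK|Kn2] := eqVneq K n; first by rewrite nK binn !muln0 !mul0n !add0n !muln1 -mulnn; lia.
    by rewrite ['C(K, n)]bin_small ?muln0 ?mul0n //; lia.
  have -> : (n.+1 ^ 2 * (n`! * K`! * 'C(K, n)) =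
     n.+1 * n`! * K`! * (n.+1 * 'C(K, n)))%N by nia.
  have -> : (n.+1 * n`! * (K.+1 * K`!) * ('C(K, n.+1) + 'C(K, n)) =
     n.+1 * n`! * K`! * (K.+1 * 'C(K, n.+1) + K.+1 * 'C(K, n)))%N by lia.
  rewrite -[(_ * (2 * n + 3))%N]mulnA -!mulnDr; congr (_ * _)%N.
  have {}e2 : (n.+1 * 'C(K, n.+1) + n * 'C(K, n) = K * 'C(K, n))%N.
    by rewrite e2 -mulnDl subnK // ltnW.
  move: nK e2 {e1 IHK}; move: 'C(K, n.+1) 'C(K, n) => x y nK e2.
  have : ((K - n.+1) * x + n.+1 * x = K * x)%N by rewrite -mulnDl subnK.
  lia.
have h' : (n.+1`! * K.+1`! * 'C(K.+1, n.+1))%:R = (n.+2`! * K`! * 'C(K, n.+2))%:R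
  + (n.+1`! * K`! * 'C(K, n.+1))%:R * (2 * n + 3)%:R
   + (n.+1 ^ 2)%:R * (n`! * K`! * 'C(K, n))%:R :> int.
  by rewrite -!natrM -!natrD h.
rewrite h' !exprD ![z ^+ _.+1]exprS.
ring.
Qed.

Lemma pade_rem0 K : pade_rem 0 K = euler_sum K.
Proof. by apply: eq_bigr => k _; rewrite bin0 muln1 mul1n. Qed.

Lemma pade_rem1 K : pade_rem 1 K =
  (1 - z) * euler_sum K - 1 + K`!%:R * z ^+ K.
Proof.
elim: K => [|K IHK]; first by rewrite /pade_rem /euler_sum !big_ord0 fact0 expr0; ring.
rewrite /pade_rem /euler_sum !big_ord_recr /= -/(pade_rem 1 K) -/(euler_sum K) IHK.
by rewrite bin1 (factS K) (_ : 1`! = 1)%N // mul1n !natrM exprD exprS -[K.+1]addn1 natrD; ring.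
Qed.

(** Both [padeQ n * euler_sum K - padeP n] and [pade_rem n K] obey the three-term recurrence in [n],
    the latter up to a multiple of [K!]; so the congruence passes from [n] and [n.+1] to [n.+2]. *)
Lemma pade_rem_cong n K :
  exists t, padeQ n * euler_sum K - padeP n = pade_rem n K + K`!%:R * t.
Proof.
suff [] : (exists t, padeQ n * euler_sum K - padeP n = pade_rem n K + K`!%:R * t)
  /\ (exists t, padeQ n.+1 * euler_sum K - padeP n.+1 =
        pade_rem n.+1 K + K`!%:R * t) by [].
elim: n => [|n [[t1 h1] [t2 h2]]].
  split; first by exists 0; rewrite pade_rem0 /padeQ /padeP /=; ring.
  by exists (- z ^+ K); rewrite pade_rem1 /padeQ /padeP /=; ring.
split; first by exists t2.
exists ((1 - (2 * n + 3)%:R * z) * t2 - (n.+1 ^ 2)%:R * z ^+ 2 * t1 -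
  (n.+1`! * 'C(K, n.+1))%:R * z ^+ (n.+1 + K)).
have -> : padeQ n.+2 * euler_sum K - padeP n.+2 =
  (1 - (2 * n + 3)%:R * z) * (padeQ n.+1 * euler_sum K - padeP n.+1)
  - (n.+1 ^ 2)%:R * z ^+ 2 * (padeQ n * euler_sum K - padeP n).
  by rewrite padeQ_rec padeP_rec; ring.
by rewrite h1 h2 pade_rem_rec !natrM; ring.
Qed.

(** Termwise: the binomial coefficient vanishes for [k < n], and [n!] divides [k!] otherwise. *)
Lemma pade_rem_dvd n K : ((n`! ^ 2)%:R %| pade_rem n K)%Z.
Proof.
apply: rpred_sum => k _; apply: dvdz_mulr.
have [kn|nk] := ltnP k n; first by rewrite bin_small // muln0 dvdz0.
have h : (n`! ^ 2 %| n`! * k`! * 'C(k, n))%N.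
  by rewrite -mulnn dvdn_mulr // dvdn_mul // fact_dvd.
by rewrite !natz.
Qed.

Lemma pade_approx_dvd n K : (2 * n <= K)%N ->
  ((n`! ^ 2)%:R %| padeQ n * euler_sum K - padeP n)%Z.
Proof.
move=> nK; have [t ->] := pade_rem_cong n K.
apply: rpredD; first exact: pade_rem_dvd.
apply: dvdz_mulr; rewrite !natz.
(* This is where [2 * n <= K] enters: the central binomial coefficient is an integer, so the square
   of [n!] divides [(2 * n)!]. *)
have h : (n`! ^ 2 %| K`!)%N.
  apply: (@dvdn_trans (2 * n)`!); last exact: fact_dvd.
  rewrite -(@bin_fact (2 * n) n) ?leq_pmull //.
  have -> : (2 * n - n = n)%N by lia.
  by rewrite mulnn dvdn_mull.
by [].
Qed.

End Pade.

(** * Convergence of the p-adic factorial series *)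

Lemma padic_abs_le_dvd p k (x : int) : prime p ->
  (padic_abs p x%:~R <= p%:R ^- k) = ((p ^ k)%N%:Z %| x)%Z.
Proof.
move=> pp; have [->|x0] := eqVneq x 0.
  by rewrite padic_abs0 dvdz0 invr_ge0 exprn_ge0.
rewrite /padic_abs intr_eq0 (negPf x0) /padic_val numq_int denq_int logn1 subr0.
have p1 : 1 < (p%:R : rat) by rewrite ltr1n prime_gt1.
rewrite exprnN ler_eXz2l // lerN2 lez_nat.
by rewrite dvdzE /= -pfactor_dvdn ?absz_gt0.
Qed.

Lemma exp_inv_small (p : nat) (e : rat) : (1 < p)%N -> 0 < e ->
  exists k, (p%:R ^- k : rat) < e.
Proof.
move=> p1 e0; exists (Num.truncn e^-1).+1.
rewrite invf_plt ?posrE ?exprn_gt0 ?ltr0n ?(ltnW p1) //.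
apply: lt_trans (truncnS_gt _) _; rewrite -natrX ltr_nat.
exact: ltn_expl.
Qed.

Section EulerSeries.
Variables (p : nat) (z : int).
Hypothesis pp : prime p.

Let u (n : nat) : Qp p := n`!%:R * (z%:~R) ^+ n.

Lemma series_euler_sum N : series u N = (euler_sum z N)%:~R.
Proof.
rewrite seriesEord /= /euler_sum rmorph_sum /=; apply: eq_bigr => i _.
by rewrite /u intrM rmorphXn /= natz -pmulrn.
Qed.

Lemma Qp_norm_int (x : int) : Qp_norm (x%:~R : Qp p) = padic_abs p x%:~R.
Proof. by rewrite -Qp_norm_ratr ratr_int. Qed.

Lemma euler_sum_dvd M N : (M <= N)%N -> (M`!%:Z %| euler_sum z N - euler_sum z M)%Z.
Proof.
move=> MN; rewrite /euler_sum -!(big_mkord xpredT (fun k => k`!%:R * z ^+ k)).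
rewrite (big_cat_nat_idem _ (leq0n M) MN) //= ?add0r // addrAC subrr add0r.
rewrite big_nat_cond; apply: rpred_sum => k /andP[/andP[Mk _] _].
apply: dvdz_mulr; rewrite natz; have := fact_dvd Mk; by [].
Qed.

Lemma euler_series_near (e : rat) : 0 < e -> exists M, forall N, (M <= N)%N ->
  Qp_norm (series u M - series u N) < e.
Proof.
move=> e0; have [k ke] := exp_inv_small (prime_gt1 pp) e0.
(* A crude threshold: [p ^ k] is itself a factor of [(p ^ k)!]. *)
exists (p ^ k)%N => N MN; apply: le_lt_trans ke.
rewrite Qp_normBC !series_euler_sum -intrB Qp_norm_int padic_abs_le_dvd //.
apply: dvdz_trans (euler_sum_dvd MN); rewrite dvdzE /=.
by rewrite dvdn_fact // leqnn expn_gt0 prime_gt0.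
Qed.

Lemma euler_series_cvg : cvgn (series u).
Proof.
apply: Qp_cauchy_cvg; apply/cauchyP => e e0.
have [M HM] := euler_series_near e0; exists (series u M).
exists M => // N /= MN; rewrite ballEmdist /=; exact: HM.
Qed.

Lemma euler_series_approx (e : rat) n : 0 < e -> exists2 N, (n <= N)%N &
  Qp_norm (euler_series (z%:~R : Qp p) - (euler_sum z N)%:~R) < e.
Proof.
move=> e0; have /metricType_numDomainType.fcvgrPdist_lt/(_ _ e0)[M _ HM] := euler_series_cvg.
exists (maxn n M); first exact: leq_maxl.
rewrite -series_euler_sum; apply: HM; exact: leq_maxr.
Qed.

(** For a partial sum S of length at least [2 * n], one has a Q - b P = Q (a - b S) + b (Q S - P).
    The first part is p-adically small because S is close to a/b, the second by [pade_approx_dvd].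
    The outcome is a divisibility of one integer that does not depend on p, so different primes can
    be combined. *)
Lemma pade_euler_dvd (a b : int) n : b != 0 ->
  euler_series (z%:~R : Qp p) = a%:~R / b%:~R ->
  ((p ^ (2 * logn p n`!))%N%:Z %| a * padeQ z n - b * padeP z n)%Z.
Proof.
move=> b0 hs; set k := (2 * _)%N.
have [|N nN HN] := @euler_series_approx (p%:R ^- k) (2 * n).
  by rewrite invr_gt0 exprn_gt0 // ltr0n prime_gt0.
have bQ : (b%:~R : Qp p) != 0.
  apply: contra b0 => /eqP h; have /eqP := Qp_norm_int b.
  by rewrite h Qp_norm0 eq_sym padic_abs_eq0 intr_eq0.
have h1 : ((p ^ k)%N%:Z %| a - b * euler_sum z N)%Z.
  rewrite -padic_abs_le_dvd // -Qp_norm_int.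
  have -> : ((a - b * euler_sum z N)%:~R : Qp p) =
     b%:~R * (euler_series (z%:~R : Qp p) - (euler_sum z N)%:~R).
    by rewrite hs mulrBr mulrCA divff // mulr1 intrB intrM.
  rewrite Qp_normM Qp_norm_int; apply: le_trans (ltW HN).
  by rewrite ler_piMl ?Qp_norm_ge0 // padic_abs_int.
have h2 : ((p ^ k)%N%:Z %| padeQ z n * euler_sum z N - padeP z n)%Z.
  apply: dvdz_trans (pade_approx_dvd z nN).
  by rewrite natz dvdzE /= /k mulnC expnM dvdn_exp2r // pfactor_dvdnn.
have -> : a * padeQ z n - b * padeP z n =
  padeQ z n * (a - b * euler_sum z N) + b * (padeQ z n * euler_sum z N - padeP z n).
  by ring.
by apply: rpredD; apply: dvdz_mull.
Qed.

End EulerSeries.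

(** * The von Mangoldt function *)

Lemma sum_nat_extend (V : nmodType) a n N (F : nat -> V) : (n <= N)%N ->
  (forall i, (n < i)%N -> F i = 0) ->
  \sum_(a <= i < n.+1) F i = \sum_(a <= i < N.+1) F i.
Proof.
move=> nN F0; rewrite (big_nat_widen _ n.+1 N.+1) // big_mkcond /=.
by apply: eq_bigr => i _; rewrite ltnS; case: leqP => // /F0.
Qed.

Lemma sum_nat_single (V : nmodType) a n c (F : nat -> V) :
  \sum_(a <= i < n | i == c) F i = if (a <= c < n)%N then F c else 0.
Proof.
case: ifP => h.
  by rewrite (big_rem c) ?mem_index_iota // eqxx /= big1_seq ?addr0 // => i /andP[/eqP ->];
     rewrite mem_rem_uniq ?iota_uniq // inE eqxx.
rewrite big1_seq // => i /andP[/eqP ->]; by rewrite mem_index_iota h.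
Qed.

Lemma sum_multiples (V : nmodType) d n (G : nat -> V) : (0 < d)%N ->
  \sum_(1 <= N < n.+1 | (d %| N)%N) G (N %/ d)%N = \sum_(1 <= k < (n %/ d).+1) G k.
Proof.
move=> d0; elim: n => [|n IHn]; first by rewrite div0n !big_geq.
rewrite big_mkcond big_nat_recr //= -big_mkcond IHn divnS //.
by case: (d %| n.+1)%N; rewrite ?addr0 ?add0n // add1n [RHS]big_nat_recr.
Qed.

Lemma sum_divisors_exchange (V : nmodType) n (H : nat -> nat -> V) :
  \sum_(1 <= d < n.+1) \sum_(1 <= k < (n %/ d).+1) H d k =
  \sum_(1 <= N < n.+1) \sum_(1 <= d < N.+1 | (d %| N)%N) H d (N %/ d)%N.
Proof.
transitivity (\sum_(1 <= N < n.+1) \sum_(1 <= d < n.+1 | (d %| N)%N) H d (N %/ d)%N).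
  under [RHS]eq_bigr do rewrite big_mkcond.
  rewrite [RHS]exchange_big /=; apply: eq_big_nat => d /andP[d1 _].
  by rewrite -sum_multiples // big_mkcond.
apply: eq_big_nat => N /andP[N1 Nn]; rewrite !(big_mkcond (fun d => d %| N)%N).
apply/esym/sum_nat_extend => // i Ni; case: ifP => // /dvdn_leq; lia.
Qed.

Section VonMangoldt.
Variable R : realType.
Implicit Types (n d N : nat) (f : nat -> R).

(** By unique factorization at most one pair (p, k) contributes. Written as a double sum, the
    function can be handled by exchanging summations, without extracting p from d. *)
Definition vonMangoldt d : R :=
  \sum_(1 <= p < d.+1 | prime p) \sum_(1 <= k < d.+1 | d == (p ^ k)%N) ln p%:R.

Lemma lnn_ge0 n : 0 <= ln (n%:R : R).
Proof. by case: n => [|n]; [rewrite ln0 | rewrite ln_ge0 // ler1n]. Qed.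

Lemma vonMangoldt_ge0 d : 0 <= vonMangoldt d.
Proof. by apply: sumr_ge0 => p _; apply: sumr_ge0 => k _; exact: lnn_ge0. Qed.

Lemma vonMangoldt_widen n d : (d <= n)%N -> vonMangoldt d =
  \sum_(1 <= p < n.+1 | prime p) \sum_(1 <= k < n.+1 | d == (p ^ k)%N) ln p%:R.
Proof.
move=> dn; rewrite /vonMangoldt.
transitivity (\sum_(1 <= p < d.+1 | prime p) \sum_(1 <= k < n.+1 | d == (p ^ k)%N) ln (p%:R : R)).
  apply: eq_bigr => p pp; rewrite !(big_mkcond (fun k => d == _)).
  apply: sum_nat_extend => // k dk; case: eqP => // dpk.
  have : (k < p ^ k)%N by apply: ltn_expl; exact: prime_gt1.
  lia.
rewrite !(big_mkcond prime); apply: sum_nat_extend => // p dp; case: ifP => // pp.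
rewrite big_nat_cond big1 // => k /andP[/andP[k1 _] /eqP dpk].
have : (p ^ 1 <= p ^ k)%N by rewrite leq_pexp2l // prime_gt0.
by rewrite -dpk expn1; lia.
Qed.

Lemma sum_vonMangoldt n f : \sum_(1 <= d < n.+1) f d * vonMangoldt d =
  \sum_(1 <= p < n.+1 | prime p) \sum_(1 <= k < n.+1 | (p ^ k <= n)%N)
     f (p ^ k)%N * ln p%:R.
Proof.
transitivity (\sum_(1 <= d < n.+1) \sum_(1 <= p < n.+1 | prime p)
   \sum_(1 <= k < n.+1 | d == (p ^ k)%N) f d * ln (p%:R : R)).
  apply: eq_big_nat => d /andP[_ dn]; rewrite (@vonMangoldt_widen n) // mulr_sumr.
  by apply: eq_bigr => p _; rewrite mulr_sumr.
rewrite exchange_big /=; apply: eq_bigr => p pp.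
under eq_bigr do rewrite big_mkcond.
rewrite exchange_big /= [RHS]big_mkcond; apply: eq_bigr => k _.
rewrite -big_mkcond sum_nat_single ltnS expn_gt0 prime_gt0 //=.
Qed.

Lemma ln_prodn (I : Type) (r : seq I) (P : pred I) (F : I -> nat) :
  (forall i, P i -> (0 < F i)%N) ->
  ln ((\prod_(i <- r | P i) F i)%N%:R : R) = \sum_(i <- r | P i) ln (F i)%:R.
Proof.
move=> F0.
suff [] : (0 < \prod_(i <- r | P i) F i)%N /\
  ln ((\prod_(i <- r | P i) F i)%N%:R : R) = \sum_(i <- r | P i) ln (F i)%:R by [].
elim/big_rec2: _ => [|i x y Pi [y0 IH]]; first by rewrite ln1.
by rewrite muln_gt0 F0 // y0 natrM lnM ?posrE ?ltr0n ?F0 // IH.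
Qed.

Lemma ln_natX n k : ln ((n ^ k)%N%:R : R) = k%:R * ln n%:R.
Proof.
case: n => [|n]; last by rewrite natrX lnXn ?ltr0n // mulr_natl.
case: k => [|k]; first by rewrite expn0 ln1 mul0r.
by rewrite exp0n // ln0 ?mulr0.
Qed.

Lemma ln_logn N : (0 < N)%N ->
  ln (N%:R : R) = \sum_(1 <= p < N.+1 | prime p) (logn p N)%:R * ln p%:R.
Proof.
move=> N0; rewrite -{1}(partnT N0) /partn ln_prodn => [|p _]; last first.
  have [pp|pN] := boolP (prime p); first by rewrite expn_gt0 prime_gt0.
  by rewrite lognE (negPf pN).
rewrite big_mkcond big_ltn //=.
rewrite [X in X + _](_ : _ = 0); last by rewrite lognE /= expn0 ln1.
rewrite add0r [RHS]big_mkcond.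
apply: eq_bigr => p _; rewrite /= ln_natX; case: ifPn => // pN.
by rewrite lognE (negPf pN) mul0r.
Qed.

Lemma logn_sum p N n : prime p -> (0 < N <= n)%N ->
  (logn p N = \sum_(1 <= k < n.+1 | p ^ k %| N) 1)%N.
Proof.
move=> pp /andP[N0 Nn]; rewrite big_mkcond /=.
have lN : (logn p N < N)%N.
  by apply: leq_trans (ltn_expl _ (prime_gt1 pp)) (dvdn_leq N0 (pfactor_dvdnn _ _)).
rewrite (big_cat_nat _ (n := (logn p N).+1)) //=; last by lia.
rewrite [X in (_ + X)%N]big_nat_cond [X in (_ + X)%N]big1 ?addn0; last first.
  by move=> k /andP[/andP[h _] _]; rewrite pfactor_dvdn // leqNgt h.
rewrite (eq_big_nat _ _ (F2 := fun=> 1%N)) ?sum_nat_const_nat ?muln1 ?subSS ?subn0 //.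
by move=> k /andP[_ h]; rewrite pfactor_dvdn // -ltnS h.
Qed.

Lemma sum_divisors_vonMangoldt N : (0 < N)%N ->
  \sum_(1 <= d < N.+1 | (d %| N)%N) vonMangoldt d = ln N%:R.
Proof.
move=> N0; rewrite ln_logn // big_mkcond /=.
transitivity (\sum_(1 <= d < N.+1) (d %| N)%:R * vonMangoldt d).
  by apply: eq_bigr => d _; case: ifP; rewrite ?mul1r ?mul0r.
rewrite sum_vonMangoldt; apply: eq_bigr => p pp.
rewrite (@logn_sum p N N) ?N0 ?leqnn // natr_sum mulr_suml big_mkcond [RHS]big_mkcond /=.
apply: eq_bigr => k _; case: (boolP (p ^ k %| N)%N) => h; last by rewrite mul0r if_same.
by rewrite dvdn_leq.
Qed.

Lemma vonMangoldt_le_ln d : vonMangoldt d <= ln d%:R.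
Proof.
case: d => [|d]; first by rewrite /vonMangoldt big_geq // ln0.
rewrite -(@sum_divisors_vonMangoldt d.+1) // big_mkcond big_nat_recr //= dvdnn lerDr.
by apply: sumr_ge0 => i _; case: ifP => // _; exact: vonMangoldt_ge0.
Qed.

Lemma vonMangoldt_prime p : prime p -> vonMangoldt p = ln p%:R.
Proof.
move=> pp; apply/eqP; rewrite eq_le vonMangoldt_le_ln /=.
have p1 := prime_gt1 pp; rewrite /vonMangoldt big_mkcond big_nat_recr /=; last by lia.
rewrite pp [X in _ + X]big_mkcond [X in _ + X]big_ltn; last by lia.
rewrite expn1 eqxx addrCA lerDl addr_ge0 // sumr_ge0 // => i _.
  by case: ifP => // _; apply: sumr_ge0 => *; exact: lnn_ge0.
by case: ifP => // _; exact: lnn_ge0.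
Qed.

(** Legendre's formula in logarithmic form: each ln N with N at most n is expanded as a divisor sum
    of the von Mangoldt function. *)
Lemma ln_fact n : ln (n`!%:R : R) = \sum_(1 <= d < n.+1) (n %/ d)%N%:R * vonMangoldt d.
Proof.
transitivity (\sum_(1 <= d < n.+1) \sum_(1 <= k < (n %/ d).+1) vonMangoldt d).
  rewrite sum_divisors_exchange fact_prod big_add1 ln_prodn => [|i _]; last by [].
  rewrite [RHS]big_add1 /=; apply: eq_bigr => i _.
  by rewrite sum_divisors_vonMangoldt.
by apply: eq_bigr => d _; rewrite sumr_const_nat subn1 /= mulr_natl.
Qed.
End VonMangoldt.

(** * Chebyshev and Mertens estimates *)

Section Estimates.
Variable R : realType.
Implicit Types (n d N : nat) (f : nat -> R).

Lemma ln_le_subr1 (x : R) : 0 < x -> ln x <= x - 1.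
Proof.
move=> x0; have := expR_ge1Dx (ln x); rewrite lnK ?posrE //; lra.
Qed.

Lemma ln_fact_le n : ln (n`!%:R : R) <= n%:R * ln n%:R.
Proof.
rewrite -ln_natX ler_ln ?posrE ?ltr0n ?fact_gt0 // ?ler_nat; last first.
  by case: n => // n; rewrite expn_gt0.
elim: n => // n IHn; rewrite factS expnS leq_mul2l /=.
by case: n IHn => // n IHn; apply: leq_trans IHn _; rewrite leq_exp2r.
Qed.

Lemma lnS_sub n : (0 < n)%N -> n%:R * (ln (n.+1%:R : R) - ln n%:R) <= 1.
Proof.
move=> n0; have n0' : 0 < (n%:R : R) by rewrite ltr0n.
rewrite -ln_div ?posrE ?ltr0n //.
have := @ln_le_subr1 (n.+1%:R / n%:R); rewrite divr_gt0 ?ltr0n // => /(_ isT) h.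
rewrite mulrC -ler_pdivlMr //; apply: le_trans h _.
by rewrite -[n.+1]addn1 natrD mulrDl divff ?gt_eqF //; lra.
Qed.

Lemma ln_fact_ge n : n%:R * ln n%:R - n%:R <= ln (n`!%:R : R).
Proof.
elim: n => [|n IHn]; first by rewrite mul0r subr0 ln1.
have [->|n0] := posnP n; first by rewrite ln1 mulr0 sub0r lerN10.
rewrite factS natrM lnM ?posrE ?ltr0n ?fact_gt0 //.
have := lnS_sub n0; rewrite -[X in X%:R * ln _]addn1 natrD.
rewrite -[X in _ - X%:R]addn1 natrD; lra.
Qed.

Definition chebyshev_psi n : R := \sum_(1 <= d < n.+1) vonMangoldt R d.

Lemma bin_le_exp n k : ('C(n, k) <= 2 ^ n)%N.
Proof.
have [nk|kn] := ltnP n k; first by rewrite bin_small.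
rewrite -[2%N]/(1 + 1)%N expnDn (bigD1 (Ordinal (kn : (k < n.+1)%N))) //=.
by rewrite !exp1n !muln1 leq_addr.
Qed.

(** Both sides are compared with the logarithm of the central binomial coefficient: the weight
    [(2 * n) %/ d - 2 * (n %/ d)] is never negative and is at least 1 for n < d <= 2n. *)
Lemma chebyshev_psi_double n :
  chebyshev_psi (2 * n) - chebyshev_psi n <= (2 * n)%:R * ln 2.
Proof.
have -> : chebyshev_psi n = \sum_(1 <= d < (2 * n).+1) (d <= n)%:R * vonMangoldt R d.
  rewrite -(@sum_nat_extend _ 1 n (2 * n)); [|lia|by move=> i; rewrite ltnNge => /negPf ->;
    rewrite mul0r].
  by apply: eq_big_nat => d /andP[_]; rewrite ltnS => ->; rewrite mul1r.
rewrite /chebyshev_psi -sumrB.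
apply: (@le_trans _ _ (ln ((2 * n)`!%:R : R) - 2 * ln (n`!%:R : R))).
  rewrite !ln_fact mulr_sumr.
  rewrite (@sum_nat_extend _ 1 n (2 * n)); [|lia|by move=> i ni; rewrite divn_small // mul0r mulr0].
  rewrite -sumrB; apply: ler_sum_nat => d /andP[d1 dn].
  rewrite -{1}[vonMangoldt R d]mul1r -mulrBl mulrA -mulrBl ler_wpM2r ?vonMangoldt_ge0 //.
  have h : (1 + 2 * (n %/ d) <= (d <= n) + (2 * n) %/ d)%N.
    have [dn'|nd] := leqP d n.
      rewrite leq_add2l. rewrite leq_divRL // mulnAC -mulnA [(d * _)%N]mulnC leq_mul2l /=
        -leq_divRL //.
    by rewrite divn_small // leq_divRL //; lia.
  by move: h; rewrite -(ler_nat R) natrD [leRHS]natrD natrM; lra.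
rewrite -(bin_fact (leq_pmull n (isT : 0 < 2)%N)).
have -> : (2 * n - n = n)%N by lia.
rewrite !natrM !lnM ?posrE ?ltr0n ?fact_gt0 // ?muln_gt0 ?bin_gt0 ?leq_pmull ?fact_gt0 //.
have : ln ('C(2 * n, n)%:R : R) <= ln ((2 ^ (2 * n))%N%:R : R).
  by rewrite ler_ln ?posrE ?ltr0n ?bin_gt0 ?leq_pmull ?expn_gt0 // ler_nat bin_le_exp.
rewrite ln_natX natrM; lra.
Qed.

(** Induction by halving. If psi(k) <= c k, the odd step n = 2k + 1 adds at most 2k from the
    doubling and at most n - 1 = 2k from n itself; (c + 4) k <= c (2k + 1) holds with c = 4. *)
Lemma chebyshev_psi_le n : chebyshev_psi n <= 4 * n%:R.
Proof.
have ln2 : ln (2 : R) <= 1 by have := @ln_le_subr1 2; rewrite ltr0n => /(_ isT); lra.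
elim/ltn_ind: n => n IHn.
have [->|n0] := posnP n; first by rewrite /chebyshev_psi big_geq // mulr0.
have [k nk] : exists k, n = (2 * k)%N \/ n = (2 * k).+1.
  by exists (n %/ 2)%N; rewrite {1 3}(divn_eq n 2) modn2; case: odd; lia.
have k0 : (0 : R) <= k%:R by [].
case: nk => nk.
  have := chebyshev_psi_double k; have := IHn k; rewrite -nk.
  have -> : (k < n)%N by lia.
  move=> /(_ isT); rewrite nk natrM; nra.
have -> : chebyshev_psi n = chebyshev_psi (2 * k) + vonMangoldt R n.
  by rewrite nk /chebyshev_psi big_nat_recr.
have := chebyshev_psi_double k; have := IHn k; have -> : (k < n)%N by lia.
move=> /(_ isT); have := vonMangoldt_le_ln R n; have := @ln_le_subr1 n%:R;
  rewrite ltr0n n0 => /(_ isT).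
rewrite nk -[(2 * k).+1]addn1 natrD natrM; nra.
Qed.

(** Replacing the integer part in [ln_fact] by n/d costs less than 1 for each d, in total at most
    psi(n) <= 4n; dividing by n leaves the 4. *)
Lemma mertens_upper n : (0 < n)%N ->
  \sum_(1 <= d < n.+1) vonMangoldt R d / d%:R <= ln n%:R + 4.
Proof.
move=> n0; have n0' : 0 < (n%:R : R) by rewrite ltr0n.
rewrite -(ler_pM2l n0') mulrDr mulr_sumr.
apply: (@le_trans _ _ (ln (n`!%:R : R) + chebyshev_psi n)); last first.
  by have := ln_fact_le n; have := chebyshev_psi_le n; lra.
rewrite ln_fact -big_split /=; apply: ler_sum_nat => d /andP[d0 _].
rewrite mulrCA mulrC -[X in _ + X]mul1r -mulrDl ler_wpM2r ?vonMangoldt_ge0 //.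
rewrite ler_pdivrMr ?ltr0n // -(natrD _ _ 1) -natrM ler_nat addn1.
by rewrite ltnW // ltn_ceil.
Qed.

Lemma mertens_lower n : (0 < n)%N ->
  ln n%:R - 1 <= \sum_(1 <= d < n.+1) vonMangoldt R d / d%:R.
Proof.
move=> n0; have n0' : 0 < (n%:R : R) by rewrite ltr0n.
rewrite -(ler_pM2l n0') mulrBr mulr_sumr mulr1.
apply: le_trans (ln_fact_ge n) _.
rewrite ln_fact; apply: ler_sum_nat => d /andP[d0 _].
rewrite mulrCA mulrC ler_wpM2l ?vonMangoldt_ge0 //.
by rewrite ler_pdivlMr ?ltr0n // -natrM ler_nat leq_trunc_div.
Qed.

Lemma sum_geometric_le (x : R) a b : 0 <= x -> (1 - x) * \sum_(a <= k < b) x ^+ k <= x ^+ a.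
Proof.
move=> x0; have [ab|ba] := leqP a b; last by rewrite big_geq ?mulr0 ?exprn_ge0 // ltnW.
suff -> : (1 - x) * \sum_(a <= k < b) x ^+ k = x ^+ a - x ^+ b.
  by rewrite lerBlDr lerDl exprn_ge0.
rewrite mulrBl mul1r; rewrite -opprB mulr_sumr -sumrB.
rewrite -[RHS]opprB; congr (- _); under eq_bigr do rewrite -exprS.
by rewrite telescope_sumr.
Qed.

(** Only powers of primes dividing m occur, and for each such p the series of p^(-k), k >= 1, is at
    most 1. Hence the classes not coprime to m carry no logarithmic density. *)
Lemma sum_noncoprime_bound m n : (0 < m)%N ->
  \sum_(1 <= d < n.+1) (~~ coprime d m)%:R / d%:R * vonMangoldt R d <=
  \sum_(1 <= p < m.+1 | prime p) ln p%:R.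
Proof.
move=> m0; rewrite sum_vonMangoldt.
apply: (@le_trans _ _ (\sum_(1 <= p < n.+1 | prime p) (p <= m)%:R * ln (p%:R : R))).
  apply: ler_sum => p pp; have p1 := prime_gt1 pp.
  have p0 : 0 < (p%:R : R) by rewrite ltr0n prime_gt0.
  rewrite -mulr_suml ler_wpM2r ?lnn_ge0 //.
  apply: (@le_trans _ _ (\sum_(1 <= k < n.+1) (p <= m)%:R * p%:R^-1 ^+ k)).
    rewrite big_mkcond; apply: ler_sum_nat => k /andP[k0 _].
    have h0 : 0 <= (p <= m)%:R * (p%:R^-1 : R) ^+ k.
      by rewrite mulr_ge0 // exprn_ge0 // invr_ge0 ltW.
    case: ifP => // _; rewrite natrX exprVn; apply: ler_wpM2r.
      by rewrite invr_ge0 exprn_ge0 // ltW.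
    rewrite ler_nat coprime_pexpl // prime_coprime // negbK.
    by case: (boolP (p %| m)%N) => // /dvdn_leq -> .
  rewrite -mulr_sumr; apply: ler_piMr => //.
  have := @sum_geometric_le p%:R^-1 1 n.+1; rewrite invr_ge0 ltW // => /(_ isT).
  have : (p%:R^-1 : R) <= 2^-1 by rewrite lef_pV2 ?posrE // ler_nat.
  have : 0 <= \sum_(1 <= k < n.+1) (p%:R^-1 : R) ^+ k.
    by apply: sumr_ge0 => k _; rewrite exprn_ge0 // invr_ge0 ltW.
  rewrite expr1; nra.
have [mn|nm] := leqP n m.
  rewrite (big_nat_widen _ n.+1 m.+1) // big_mkcond [leRHS]big_mkcond.
  apply: ler_sum => p _; case: (prime p) => //=; case: ifP => _; rewrite ?lnn_ge0 //.
  by rewrite ler_piMl ?lnn_ge0 // lern1 leq_b1.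
rewrite [leRHS](big_nat_widen _ m.+1 n.+1); last by lia.
rewrite big_mkcond [leRHS]big_mkcond; apply: ler_sum => p _.
by case: (prime p) => //=; rewrite ltnS; case: leqP => _; rewrite ?mul1r ?mul0r.
Qed.

(* Telescoping with g(k) = (ln k + 2) / k, since g(k-1) - g(k) >= ln k / (k(k-1)). *)
Lemma sum_lnn_bound n : (0 < n)%N ->
  \sum_(1 <= k < n.+1) ln k%:R / (k%:R * (k%:R - 1)) + (ln n%:R + 2) / n%:R <= (2 : R).
Proof.
elim: n => // n IHn _; have [->|n0] := posnP n.
  by rewrite big_nat1 ln1 mul0r add0r add0r divr1.
apply: le_trans (IHn n0); rewrite big_nat_recr //= -addrA lerD2l.
have n0' : 0 < (n%:R : R) by rewrite ltr0n.
have h := lnS_sub n0; have eS : n.+1%:R = n%:R + 1 :> R by rewrite -addn1 natrD.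
rewrite eS in h *; rewrite addrK.
have h2 := @lnn_ge0 R n.
have -> : ln (n%:R + 1) / ((n%:R + 1) * n%:R) + (ln (n%:R + 1) + 2) / (n%:R + 1) =
   (ln (n%:R + 1) + n%:R * (ln (n%:R + 1) + 2)) / ((n%:R + 1) * n%:R) :> R.
  by field; rewrite !gt_eqF //; lra.
have n1 : 0 < n%:R + 1 :> R by lra.
rewrite ler_pdivrMr ?mulr_gt0 //.
have -> : (ln n%:R + 2) / n%:R * ((n%:R + 1) * n%:R) = (ln n%:R + 2) * (n%:R + 1) :> R.
  by field; rewrite !gt_eqF.
have h1 : ln (n%:R + 1) - ln n%:R <= 1 :> R.
  apply: le_trans h; rewrite ler_peMl ?ler1n // subr_ge0 ler_ln ?posrE //; lra.
nra.
Qed.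

(** The powers p^k with k >= 2 contribute at most the geometric tail ln p / (p (p - 1)); summed over
    all integers instead of the primes this is at most 2 by [sum_lnn_bound]. *)
Lemma sum_prime_powers_bound f n : (forall d, 0 <= f d <= 1) ->
  \sum_(1 <= d < n.+1) f d / d%:R * vonMangoldt R d <=
  \sum_(1 <= p < n.+1 | prime p) f p * ln p%:R / p%:R + 2.
Proof.
move=> f01; rewrite sum_vonMangoldt.
apply: (@le_trans _ _ (\sum_(1 <= p < n.+1 | prime p)
   (f p * ln p%:R / p%:R + ln p%:R / (p%:R * (p%:R - 1))))).
  rewrite big_nat_cond [leRHS]big_nat_cond.
  apply: ler_sum => p /andP[/andP[p0 pn] pp]; have p1 := prime_gt1 pp.
  have p0' : 1 < (p%:R : R) by rewrite ltr1n.
  have -> : \sum_(1 <= k < n.+1 | (p ^ k <= n)%N) f (p ^ k)%N / (p ^ k)%:R * ln p%:R =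
    f p * ln p%:R / p%:R + \sum_(2 <= k < n.+1 | (p ^ k <= n)%N) f (p ^ k)%N / (p ^ k)%:R * ln p%:R.
    rewrite big_mkcond big_ltn /=; last by lia.
    by rewrite expn1 -(ltnS p) pn [RHS]addrC [RHS]addrC mulrAC -big_mkcond.
  rewrite lerD2l big_mkcond.
  apply: (@le_trans _ _ (\sum_(2 <= k < n.+1) p%:R^-1 ^+ k * ln p%:R)).
    apply: ler_sum => k _; have h0 : 0 <= (p%:R^-1 : R) ^+ k.
      by rewrite exprn_ge0 // invr_ge0; lra.
    case: ifP => _; last by rewrite mulr_ge0 ?lnn_ge0.
    rewrite ler_wpM2r ?lnn_ge0 // natrX -exprVn ler_piMl //.
    by case/andP: (f01 (p ^ k)%N).
  rewrite -mulr_suml mulrC ler_wpM2l ?lnn_ge0 //.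
  have := @sum_geometric_le p%:R^-1 2 n.+1; rewrite invr_ge0 ltW; last by lra.
  move=> /(_ isT) h.
  have -> : (p%:R * (p%:R - 1))^-1 = p%:R^-1 ^+ 2 / (1 - p%:R^-1) :> R.
    by field; rewrite !gt_eqF //; lra.
  rewrite ler_pdivlMr 1?mulrC // subr_gt0 invf_lt1 //; lra.
rewrite big_split lerD2l /=.
have [->|n0] := posnP n; first by rewrite big_geq.
apply: le_trans (sum_lnn_bound n0); rewrite -[leLHS]addr0 lerD //; last first.
  by rewrite divr_ge0 // addr_ge0 ?lnn_ge0.
rewrite big_mkcond; apply: ler_sum => p _; case: ifP => // _.
rewrite divr_ge0 ?lnn_ge0 //; case: p => [|p]; first by rewrite mul0r.
by rewrite mulr_ge0 // subr_ge0 ler1n.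
Qed.

End Estimates.

(** * Abel summation and Moebius inversion *)

Lemma sum_hyperbola_sym (V : nmodType) n (G : nat -> nat -> V) :
  \sum_(1 <= d < n.+1) \sum_(1 <= k < (n %/ d).+1) G d k =
  \sum_(1 <= k < n.+1) \sum_(1 <= d < (n %/ k).+1) G d k.
Proof.
have E (H : nat -> nat -> V) : \sum_(1 <= d < n.+1) \sum_(1 <= k < (n %/ d).+1) H d k =
   \sum_(1 <= d < n.+1) \sum_(1 <= k < n.+1) if (d * k <= n)%N then H d k else 0.
  apply: eq_big_nat => d /andP[d0 _].
  transitivity (\sum_(1 <= k < (n %/ d).+1) if (d * k <= n)%N then H d k else 0).
    by apply: eq_big_nat => k /andP[_]; rewrite ltnS leq_divRL // mulnC => ->.
  apply: sum_nat_extend; first exact: leq_div.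
  by move=> k; rewrite ltn_divLR // mulnC ltnNge => /negPf ->.
rewrite E (E (fun k d => G d k)) exchange_big /=.
by apply: eq_bigr => k _; apply: eq_bigr => d _; rewrite mulnC.
Qed.

Section Abel.
Variable R : realType.

Lemma abel_bound (c b : nat -> R) (E : R) M N : (M <= N)%N ->
  (forall n, (M <= n)%N -> `|\sum_(M <= i < n) c i| <= E) ->
  (forall n, (M <= n)%N -> 0 <= b n) ->
  (forall n, (M <= n)%N -> b n.+1 <= b n) ->
  `|\sum_(M <= i < N) c i * b i| <= E * b M.
Proof.
move=> MN cE b0 bd.
(* Summation by parts as an induction: after removal of the boundary term at [N], the bound
   telescopes in [b]. *)
have H : `|\sum_(M <= i < N) c i * b i - (\sum_(M <= i < N) c i) * b N| <= E * (b M - b N).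
  elim: N MN => [|N IHN] MN.
    by move: MN; rewrite leqn0 => /eqP ->; rewrite !big_geq // mul0r !subrr normr0 mulr0.
  have [/eqP ->|nMN] := boolP (M == N.+1); first by rewrite !big_geq // mul0r !subrr normr0 mulr0.
  have {}MN : (M <= N)%N by lia.
  rewrite !big_nat_recr //=.
  set s := \sum_(_ <= i < _) c i; set t := \sum_(_ <= i < _) _.
  have -> : t + c N * b N - (s + c N) * b N.+1 = (t - s * b N) + (s + c N) * (b N - b N.+1).
    by ring.
  apply: le_trans (ler_normD _ _) _.
  have -> : E * (b M - b N.+1) = E * (b M - b N) + E * (b N - b N.+1) by ring.
  apply: lerD; first exact: IHN.
  rewrite normrM [`|b N - _|]ger0_norm ?subr_ge0 ?bd // ler_wpM2r ?subr_ge0 ?bd //.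
  by have := cE N.+1; rewrite big_nat_recr //=; apply; lia.
rewrite -[X in `|X|](subrK ((\sum_(M <= i < N) c i) * b N)).
apply: le_trans (ler_normD _ _) _.
have -> : E * b M = E * (b M - b N) + E * b N by ring.
apply: lerD => //; rewrite normrM [`|b N|]ger0_norm ?b0 // ler_wpM2r ?b0 //.
exact: cE.
Qed.

Lemma partial_sum_bound (c : nat -> R) D M n : (M <= n)%N ->
  (forall n, `|\sum_(0 <= i < n) c i| <= D) -> `|\sum_(M <= i < n) c i| <= 2 * D.
Proof.
move=> Mn cD; have -> : \sum_(M <= i < n) c i = \sum_(0 <= i < n) c i - \sum_(0 <= i < M) c i.
  by rewrite [X in _ = X - _](big_cat_nat _ (n := M)) //= addrAC subrr add0r.
by apply: le_trans (ler_normB _ _) _; have := cD n; have := cD M; lra.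
Qed.

Lemma harmonic_tail_bound (c : nat -> R) D M n : (0 < M <= n)%N ->
  (forall n, `|\sum_(0 <= i < n) c i| <= D) ->
  `|\sum_(M <= k < n) c k / k%:R| <= 2 * D / M%:R.
Proof.
move=> /andP[M0 Mn] cD; apply: (@abel_bound c (fun k => k%:R^-1)) => // [k Mk|k Mk].
- exact: partial_sum_bound.
- by rewrite lef_pV2 ?posrE ?ltr0n ?ler_nat; lia.
Qed.

(** Abel summation needs ln k / k to decrease, which follows from k (ln(k+1) - ln k) <= 1 <= ln k.
    The elementary bound ln 4 >= 1 gives this from 4 on; the terms at 2 and 3 are estimated
    directly. Each of these three pieces costs 2D. *)
Lemma ln_harmonic_bound (c : nat -> R) D n :
  (forall n, `|\sum_(0 <= i < n) c i| <= D) ->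
  `|\sum_(1 <= k < n.+1) c k * (ln k%:R / k%:R)| <= 6 * D.
Proof.
move=> cD; have D0 : 0 <= D by apply: le_trans (cD 0%N).
have c2 k : `|c k * (ln k%:R / k%:R)| <= 2 * D.
  rewrite normrM [`|_ / _|]ger0_norm; last by rewrite divr_ge0 // lnn_ge0.
  have h : `|c k| <= 2 * D by have := @partial_sum_bound c D k k.+1 (leqnSn _) cD; rewrite big_nat1.
  rewrite -[leRHS]mulr1; apply: ler_pM => //; first by rewrite divr_ge0 // lnn_ge0.
  case: k {h} => [|k]; first by rewrite ln0 // mul0r.
  by rewrite ler_pdivrMr ?ltr0n // mul1r ltW // ln_sublinear.
have ln4 : (1 : R) <= ln 4%:R.
  have h : ln (4%:R : R) = 2 * ln 2.
    by rewrite (_ : 4%:R = 2%:R ^+ 2) ?lnXn ?ltr0n // ?mulr_natl // -natrX.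
  have := @ln_le_subr1 R 2^-1; rewrite invr_gt0 ltr0n => /(_ isT).
  rewrite lnV ?posrE ?ltr0n // h; lra.
have [n3|n3] := leqP n 2.
  apply: le_trans (ler_norm_sum _ _ _) _.
  apply: (@le_trans _ _ (\sum_(1 <= k < n.+1) 2 * D)); first exact: ler_sum.
  rewrite sumr_const_nat subn1 /= -mulr_natl.
  have : (n%:R : R) <= 2%:R by rewrite ler_nat.
  nra.
rewrite 3?big_ltn; try lia.
rewrite ln1 mul0r mulr0 add0r addrA.
apply: le_trans (ler_normD _ _) _.
have h23 : `|c 2%N * (ln 2%:R / 2%:R) + c 3%N * (ln 3%:R / 3%:R)| <= 4 * D.
  by apply: le_trans (ler_normD _ _) _; have := c2 2%N; have := c2 3%N; lra.
suff : `|\sum_(4 <= k < n.+1) c k * (ln k%:R / k%:R)| <= 2 * D * (ln 4%:R / 4%:R).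
  have : ln (4%:R : R) / 4%:R <= 1.
    by rewrite ler_pdivrMr ?ltr0n // mul1r ltW // ln_sublinear.
  nra.
apply: (@abel_bound c (fun k => ln k%:R / k%:R)) => // [k Mk|k Mk|k Mk].
- exact: partial_sum_bound.
- by rewrite divr_ge0 // lnn_ge0.
have k0 : 0 < (k%:R : R) by rewrite ltr0n; lia.
rewrite ler_pdivrMr ?ltr0n // mulrAC ler_pdivlMr //.
have k0' : (0 < k)%N by lia.
have eS : k.+1%:R = k%:R + 1 :> R by rewrite -addn1 natrD.
have := lnS_sub R k0'; rewrite [X in _ <= _ * X]eS.
have : ln (4%:R : R) <= ln k%:R by rewrite ler_ln ?posrE ?ltr0n // ler_nat.
nra.
Qed.
End Abel.

Section Moebius.
Variable R : realType.

Definition moebius n : R :=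
  if all (fun p => logn p n == 1)%N (primes n) then (-1) ^+ size (primes n) else 0.

Lemma moebius_norm n : `|moebius n| <= 1.
Proof. by rewrite /moebius; case: ifP; rewrite ?normr0 ?ler01 // normrX normrN1 expr1n. Qed.

Lemma moebius1 : moebius 1 = 1.
Proof. by []. Qed.

Lemma moebius_primeM p e : prime p -> (0 < e)%N ->
  moebius (p * e) = if (p %| e)%N then 0 else - moebius e.
Proof.
move=> pp e0; have p0 := prime_gt0 pp.
have lM q : logn q (p * e) = ((q == p) + logn q e)%N by rewrite lognM // logn_prime.
have PM q : (q \in primes (p * e)) = (q == p) || (q \in primes e).
  by rewrite primesM // (primes_prime pp) inE.
case: ifP => pe.
  rewrite /moebius; case: ifP => // /allP/(_ p).
  rewrite PM eqxx lM eqxx => /(_ isT).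
  have : (0 < logn p e)%N by rewrite logn_gt0 mem_primes pp e0.
  by case: (logn p e).
have pn : p \notin primes e by rewrite mem_primes pp e0 pe.
have pm : perm_eq (primes (p * e)) (p :: primes e).
  by apply: uniq_perm; rewrite /= ?primes_uniq ?pn // => q; rewrite PM inE.
rewrite /moebius (perm_all _ pm) (perm_size pm) /= lM eqxx.
have -> : logn p e = 0%N by apply/eqP; rewrite -leqn0 leqNgt logn_gt0.
rewrite /= (@eq_in_all _ _ (fun q => logn q e == 1)%N) => [|q qe].
  by case: ifP => _; rewrite ?oppr0 // exprS mulN1r.
rewrite lM; have [qp|//] := eqVneq q p; by rewrite -qp qe in pn.
Qed.

(** With p the least prime factor of N, the divisors not divisible by p cancel against their
    multiples by p; divisors divisible by p^2 contribute nothing. *)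
Lemma sum_moebius N : (0 < N)%N ->
  \sum_(1 <= d < N.+1 | (d %| N)%N) moebius d = (N == 1)%:R.
Proof.
move=> N0; have [->|N1] := eqVneq N 1%N; first by rewrite big_mkcond big_nat1 moebius1.
have pp : prime (pdiv N) by apply: pdiv_prime; lia.
set p := pdiv N in pp; have p0 := prime_gt0 pp; have pN : (p %| N)%N by exact: pdiv_dvd.
rewrite (bigID (fun d => p %| d)%N) /=.
suff -> : \sum_(1 <= d < N.+1 | (d %| N)%N && (p %| d)%N) moebius d =
  - \sum_(1 <= d < N.+1 | (d %| N)%N && ~~ (p %| d)%N) moebius d by rewrite addNr.
transitivity (\sum_(1 <= d < N.+1 | (p %| d)%N)
   (if (p * (d %/ p) %| N)%N then moebius (p * (d %/ p)) else 0)).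
  rewrite big_mkcond [RHS]big_mkcond; apply: eq_bigr => d _.
  by case: (boolP (p %| d)%N) => [pd|_]; rewrite ?andbF // andbT mulnC divnK.
rewrite (sum_multiples N (fun e => if (p * e %| N)%N then moebius (p * e) else 0) p0).
rewrite (@sum_nat_extend _ 1 _ N) ?leq_div // => [|e]; last first.
  by rewrite ltn_divLR // mulnC => h; case: ifP => // /(dvdn_leq N0); lia.
rewrite [X in - X]big_mkcond -sumrN; apply: eq_big_nat => e /andP[e0 _].
rewrite moebius_primeM //; case: (boolP (p %| e)%N) => pe /=; first by rewrite andbF oppr0 if_same.
rewrite andbT Gauss_dvd ?prime_coprime // pN /=.
by case: ifP; rewrite ?oppr0.
Qed.

Lemma sum_ln_convolution (F : nat -> R) n :
  \sum_(1 <= d < n.+1) vonMangoldt R d * \sum_(1 <= k < (n %/ d).+1) F (d * k)%N =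
  \sum_(1 <= N < n.+1) F N * ln N%:R.
Proof.
under eq_bigr do rewrite mulr_sumr.
rewrite sum_divisors_exchange; apply: eq_big_nat => N /andP[N0 _].
rewrite -sum_divisors_vonMangoldt // mulr_sumr; apply: eq_bigr => d dN.
by rewrite mulnC divnK // mulrC.
Qed.

Lemma sum_moebius_convolution (F : nat -> R) n : (0 < n)%N ->
  \sum_(1 <= d < n.+1) \sum_(1 <= k < (n %/ d).+1) moebius d * F (d * k)%N = F 1%N.
Proof.
move=> n0; rewrite sum_divisors_exchange.
transitivity (\sum_(1 <= N < n.+1) F N * (N == 1)%:R).
  apply: eq_big_nat => N /andP[N0 _].
  rewrite -sum_moebius // mulr_sumr; apply: eq_bigr => d dN.
  by rewrite mulnC divnK // mulrC.
rewrite big_ltn // eqxx mulr1 big_nat_cond big1 ?addr0 // => N /andP[/andP[N1 _] _].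
by rewrite gtn_eqF ?mulr0.
Qed.

(** Split ln n - ln d = (ln n - ln(dk)) + ln k. The first part collapses to N = 1 by Moebius
    inversion; in the second, ln is the convolution of the von Mangoldt function with 1, and
    inversion leaves the von Mangoldt function. The weight ln(n/d) is chosen because its sum over d
    <= n is only O(n). *)
Lemma moebius_vonMangoldt (F : nat -> R) n : (0 < n)%N ->
  \sum_(1 <= d < n.+1) moebius d * (ln n%:R - ln d%:R) *
      \sum_(1 <= k < (n %/ d).+1) F (d * k)%N =
  F 1%N * ln n%:R + \sum_(1 <= N < n.+1) F N * vonMangoldt R N.
Proof.
move=> n0.
have h1 := @sum_moebius_convolution (fun N => F N * (ln n%:R - ln N%:R)) n n0.
rewrite /= ln1 subr0 in h1.
have h2 : \sum_(1 <= d < n.+1) \sum_(1 <= k < (n %/ d).+1)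
   moebius d * (F (d * k)%N * ln k%:R) = \sum_(1 <= N < n.+1) F N * vonMangoldt R N.
  transitivity (\sum_(1 <= d < n.+1) \sum_(1 <= e < (n %/ d).+1)
     moebius d * (vonMangoldt R e * \sum_(1 <= j < (n %/ d %/ e).+1) F (d * (e * j))%N)).
    apply: eq_bigr => d _; rewrite -!mulr_sumr; congr (_ * _).
    by rewrite (sum_ln_convolution (fun N => F (d * N)%N)).
  rewrite sum_hyperbola_sym; apply: eq_big_nat => e /andP[e0 en].
  have ne0 : (0 < n %/ e)%N by rewrite divn_gt0.
  have := @sum_moebius_convolution (fun N => F (e * N)%N) _ ne0; rewrite muln1 => <-.
  rewrite mulr_suml; apply: eq_bigr => d _.
  rewrite -divnMA [(d * e)%N]mulnC divnMA -mulr_sumr mulrCA [RHS]mulrC.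
  congr (_ * (_ * _)).
  by apply: eq_bigr => j _; rewrite mulnCA mulnA.
rewrite -h1 -h2 -big_split /=; apply: eq_big_nat => d /andP[d0 _].
rewrite -big_split mulr_sumr /=; apply: eq_big_nat => k /andP[k0 _].
by rewrite natrM lnM ?posrE ?ltr0n //; ring.
Qed.
End Moebius.

(** * Nonvanishing of L(1, chi) for real characters *)

Lemma sum_divisors_primeX (V : nmodType) (F : nat -> V) p v N :
  prime p -> (0 < N)%N -> ~~ (p %| N)%N ->
  \sum_(1 <= d < (p ^ v * N).+1 | (d %| p ^ v * N)%N) F d =
  \sum_(0 <= i < v.+1) \sum_(1 <= e < N.+1 | (e %| N)%N) F (p ^ i * e)%N.
Proof.
move=> pp N0 pN; have p0 := prime_gt0 pp.
elim: v => [|v IHv].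
  rewrite big_nat1 expn0 mul1n; by apply: eq_bigr => e _; rewrite mul1n.
rewrite big_nat_recr // -IHv.
have pv0 : (0 < p ^ v.+1)%N by rewrite expn_gt0 p0.
have M0 : (0 < p ^ v.+1 * N)%N by rewrite muln_gt0 pv0.
have M0' : (0 < p ^ v * N)%N by rewrite muln_gt0 expn_gt0 p0.
rewrite (bigID (fun d => p ^ v.+1 %| d)%N) /= addrC; congr (_ + _).
  rewrite [RHS]big_mkcond /= (@sum_nat_extend _ 1 _ (p ^ v.+1 * N)).
  - rewrite big_mkcond; apply: eq_big_nat => d /andP[d0 _].
    suff -> : ((d %| p ^ v.+1 * N) && ~~ (p ^ v.+1 %| d) = (d %| p ^ v * N))%N by [].
    apply/andP/idP => [[dN pd]|dN]; last first.
      split; first by rewrite expnS -mulnA dvdn_mull.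
      apply: contra pN => pd; have := dvdn_trans pd dN.
      by rewrite expnS mulnC dvdn_pmul2l // expn_gt0 p0.
    have [d' d'p dE] := pfactor_coprime pp d0.
    rewrite pfactor_dvdn // -ltnNge ltnS in pd.
    rewrite dE mulnC dvdn_mul //; first by rewrite dvdn_exp2l.
    have : (d' %| p ^ v.+1 * N)%N by apply: dvdn_trans dN; rewrite dE dvdn_mulr.
    by rewrite Gauss_dvdr // coprime_sym coprime_pexpl.
  - by rewrite leq_mul2r leq_pexp2l // orbT.
  - by move=> d dl; case: ifP => // /(dvdn_leq M0'); lia.
transitivity (\sum_(1 <= d < (p ^ v.+1 * N).+1 | (p ^ v.+1 %| d)%N)
   (if (d %/ p ^ v.+1 %| N)%N then F (p ^ v.+1 * (d %/ p ^ v.+1))%N else 0)).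
  rewrite big_mkcond [RHS]big_mkcond; apply: eq_bigr => d _.
  case: (boolP (p ^ v.+1 %| d)%N) => [pd|_]; last by rewrite andbF.
  have -> : (d %| p ^ v.+1 * N)%N = (d %/ p ^ v.+1 %| N)%N.
    by rewrite -{1}(divnK pd) mulnC dvdn_pmul2l.
  by rewrite andbT [(p ^ v.+1 * (_ %/ _))%N]mulnC divnK.
rewrite (sum_multiples _ (fun e => if (e %| N)%N then F (p ^ v.+1 * e)%N else 0) pv0).
by rewrite mulKn // [RHS]big_mkcond.
Qed.

Section RealCharacter.
Variables (R : realType) (chi : nat -> R) (D : R).
Hypothesis chiM : forall a b, chi (a * b)%N = chi a * chi b.
Hypothesis chi1 : chi 1%N = 1.
Hypothesis chi_val : forall n, [\/ chi n = 0, chi n = 1 | chi n = -1].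

Let A N := \sum_(1 <= d < N.+1 | (d %| N)%N) chi d.

Lemma char_expn p i : chi (p ^ i)%N = chi p ^+ i.
Proof. by elim: i => [|i IH]; rewrite ?expn0 ?chi1 ?expr0 // expnS chiM IH exprS. Qed.

Lemma sum_sign_powers (x : R) v : [\/ x = 0, x = 1 | x = -1] ->
  0 <= \sum_(0 <= i < v.+1) x ^+ i /\ (~~ odd v -> 1 <= \sum_(0 <= i < v.+1) x ^+ i).
Proof.
case=> ->.
- rewrite big_ltn // expr0 big_nat_cond big1 ?addr0; first by split; rewrite ?ler01.
  by move=> i /andP[/andP[i0 _] _]; rewrite expr0n; case: i i0.
- under eq_bigr do rewrite expr1n.
  by rewrite sumr_const_nat subn0 -natr1; split=> [|_]; rewrite ?addr_ge0 // lerDr.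
- have -> : \sum_(0 <= i < v.+1) (-1) ^+ i = (~~ odd v)%:R :> R.
    elim: v => [|v IH]; first by rewrite big_nat1.
    by rewrite big_nat_recr //= IH -signr_odd /=; case: (odd v);
      rewrite /= ?expr0 ?expr1 ?add0r ?subrr.
  by split=> [|->].
Qed.

(** [A] is multiplicative, so the full power of the least prime p is split off. The local factor, a
    sum of powers of chi(p), is nonnegative whatever the value of chi(p), and at least 1 when the
    exponent is even. *)
Lemma divisor_char_sum N : (0 < N)%N ->
  0 <= A N /\ (forall s, N = (s ^ 2)%N -> 1 <= A N).
Proof.
elim/ltn_ind: N => N IH N0; have [->|N1] := eqVneq N 1%N.
  by rewrite /A big_mkcond big_nat1 chi1.
have pp : prime (pdiv N) by apply: pdiv_prime; lia.
set p := pdiv N in pp; have p0 := prime_gt0 pp; have p1 := prime_gt1 pp.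
have [N' pN' NE] := pfactor_coprime pp N0.
have pN : (p %| N)%N by exact: pdiv_dvd.
have v0 : (0 < logn p N)%N by rewrite logn_gt0 mem_primes pp N0.
set v := logn p N in NE v0.
have N'0 : (0 < N')%N by move: N0; rewrite NE muln_gt0 => /andP[].
have N'N : (N' < N)%N by rewrite NE ltn_Pmulr // -(expn0 p) ltn_exp2l.
have pnN : ~~ (p %| N')%N by rewrite -prime_coprime.
have AE : A N = (\sum_(0 <= i < v.+1) chi p ^+ i) * A N'.
  rewrite /A NE mulnC sum_divisors_primeX // mulr_suml; apply: eq_bigr => i _.
  by rewrite mulr_sumr; apply: eq_bigr => e _; rewrite chiM char_expn.
have [g0 g1] := sum_sign_powers v (chi_val p).
have [a0 a1] := IH _ N'N N'0.
rewrite AE; split=> [|s sE]; first exact: mulr_ge0.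
have s0 : (0 < s)%N by move: N0; rewrite sE expn_gt0 orbF.
have [s' ps' s'E] := pfactor_coprime pp s0.
have vE : v = (2 * logn p s)%N by rewrite /v sE lognX.
have N'E : N' = (s' ^ 2)%N.
  have : (N' * p ^ v = s' ^ 2 * p ^ v)%N.
    by rewrite -NE sE {1}s'E expnMn -expnM vE [(2 * _)%N]mulnC.
  by move/eqP; rewrite eqn_pmul2r ?expn_gt0 ?p0 // => /eqP.
rewrite -[1]mulr1; apply: ler_pM => //; first by apply: g1; rewrite vE oddM.
exact: a1 N'E.
Qed.

Hypothesis chi_sum : forall n, `|\sum_(0 <= i < n) chi i| <= D.
(** The vanishing of L(1, chi) in quantitative form: each partial sum is then minus a tail, which
    Abel summation bounds. *)
Hypothesis chi_L : forall n, `|\sum_(1 <= k < n.+1) chi k / k%:R| <= 2 * D / n.+1%:R.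

(** * Monsky's argument on the Lambert series *)

Section Lambert.
Variable s : R.
Hypothesis s01 : 0 < s < 1.
Let t := s ^+ 2.
Let geo (x : R) n := \sum_(0 <= i < n) x ^+ i.

Let t01 : 0 < t < 1.
Proof. by case/andP: s01 => s0 s1; rewrite exprn_gt0 //= exprn_ilt1 // ltW. Qed.

Let tX_ge0 k : 0 <= t ^+ k.
Proof. by rewrite exprn_ge0 // ltW //; case/andP: t01. Qed.

Let geoE (x : R) n : (1 - x) * geo x n = 1 - x ^+ n.
Proof.
rewrite /geo; elim: n => [|n IH]; first by rewrite big_geq // mulr0 expr0 subrr.
by rewrite big_nat_recr //= mulrDr IH exprS; ring.
Qed.

Let geo_ge (x : R) n : 0 < x < 1 -> n%:R * x ^+ n <= geo x n.
Proof.
case/andP=> x0 x1.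
have -> : n%:R * x ^+ n = \sum_(0 <= i < n) x ^+ n.
  by rewrite sumr_const_nat subn0 mulr_natl.
apply: ler_sum_nat => i /andP[_ iin].
by apply: ler_wiXn2l; rewrite ?ltW // ltnW.
Qed.

(** Terms i and n - 1 - i are paired by the inequality of arithmetic and geometric means. The square
    root of t that this requires is the reason for setting t = s^2. *)
Let geo_amgm n : n%:R * s ^+ n.-1 <= geo t n.
Proof.
have [s0 s1] := andP s01.
have h : geo t n = \sum_(0 <= i < n) t ^+ (n - i.+1).
  by rewrite /geo big_nat_rev /= add0n.
rewrite -(@ler_pM2l _ 2) //.
have -> : 2 * geo t n = \sum_(0 <= i < n) (t ^+ i + t ^+ (n - i.+1)).
  by rewrite big_split /= -h /geo; ring.
have -> : 2 * (n%:R * s ^+ n.-1) = \sum_(0 <= i < n) (2 * s ^+ n.-1).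
  by rewrite sumr_const_nat subn0 -[RHS]mulr_natl mulrCA.
apply: ler_sum_nat => i /andP[_ iin].
have -> : s ^+ n.-1 = s ^+ i * s ^+ (n - i.+1) by rewrite -exprD; congr (_ ^+ _); lia.
rewrite /t -!exprM ![(2 * _)%N]mulnC !exprM.
by have := sqr_ge0 (s ^+ i - s ^+ (n - i.+1)); nra.
Qed.

(* Monsky's weights: sum chi(n) b(n) is bounded because b decreases, while
   sum chi(n)/n vanishes in the limit. *)
Let b n := (n%:R * (1 - t))^-1 - t ^+ n / (1 - t ^+ n).

Let tn_lt1 n : (0 < n)%N -> 0 < 1 - t ^+ n.
Proof.
by have [t0 t1] := andP t01 => n0; rewrite subr_gt0 exprn_ilt1 // ?ltW // -lt0n.
Qed.

Let b_ge0 n : (0 < n)%N -> 0 <= b n.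
Proof.
have [t0 t1] := andP t01 => n0; rewrite /b subr_ge0.
have n0' : 0 < (n%:R : R) by rewrite ltr0n.
have u0 : 0 < 1 - t by rewrite subr_gt0.
rewrite ler_pdivrMr ?tn_lt1 // mulrC ler_pdivlMr ?mulr_gt0 // -(geoE t n).
by have := geo_ge n t01; nra.
Qed.

(** Since geo t (n+1) - t geo t n = 1, the difference of consecutive weights has the sign of geo t n
    * geo t (n+1) - n (n+1) t^n. The bounds of [geo_amgm] for n and n + 1 multiply to n (n+1)
    s^(2n-1), which is at least n (n+1) t^n. *)
Let b_decr n : (0 < n)%N -> b n.+1 <= b n.
Proof.
have [t0 t1] := andP t01; have [s0 s1] := andP s01 => n0.
have n0' : 0 < (n%:R : R) by rewrite ltr0n.
have u0 : 0 < 1 - t by rewrite subr_gt0.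
have h1 := geo_amgm n; have h2 := geo_amgm n.+1.
have g0 : 0 < geo t n by rewrite -(pmulr_rgt0 _ u0) geoE tn_lt1.
have g1 : 0 < geo t n.+1 by rewrite -(pmulr_rgt0 _ u0) geoE tn_lt1.
have key : n%:R * n.+1%:R * t ^+ n <= geo t n * geo t n.+1.
  apply: (@le_trans _ _ ((n%:R * s ^+ n.-1) * (n.+1%:R * s ^+ n))); last first.
    by apply: ler_pM => //; rewrite mulr_ge0 // exprn_ge0 // ltW.
  rewrite mulrACA ler_wpM2l ?mulr_ge0 // -exprD /t -exprM.
  by apply: ler_wiXn2l; rewrite ?(ltW s0) ?(ltW s1) //; lia.
rewrite -subr_ge0 /b -(geoE t n) -(geoE t n.+1).
have -> : (n%:R * (1 - t))^-1 - t ^+ n / ((1 - t) * geo t n) -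
   ((n.+1%:R * (1 - t))^-1 - t ^+ n.+1 / ((1 - t) * geo t n.+1)) =
   (geo t n * geo t n.+1 - n%:R * n.+1%:R * t ^+ n * (geo t n.+1 - t * geo t n)) /
   (n%:R * n.+1%:R * (1 - t) * geo t n * geo t n.+1).
  rewrite -[n.+1]addn1 natrD exprD expr1.
  by field; rewrite !gt_eqF // -?natrD ?addn1 // ltr0n.
have -> : geo t n.+1 - t * geo t n = 1.
  by rewrite /geo big_nat_recl // mulr_sumr expr0;
    under [X in _ + X - _]eq_bigr do rewrite exprS; rewrite addrK.
by rewrite mulr1 divr_ge0 ?subr_ge0 // !mulr_ge0 // ltW.
Qed.

Lemma lambert_bound N : (0 < N)%N ->
  \sum_(1 <= n < N.+1) chi n * (t ^+ n / (1 - t ^+ n)) <=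
  2 * D + 2 * D / N.+1%:R / (1 - t).
Proof.
move=> N0; have [t0 t1] := andP t01; have u0 : 0 < 1 - t by rewrite subr_gt0.
have h1 : `|\sum_(1 <= n < N.+1) chi n * b n| <= 2 * D.
  (* The first weight is exactly 1, independently of [t]; hence the bound is uniform as [t] tends to
     1. *)
  have -> : 2 * D = 2 * D * b 1 by rewrite /b expr1 mul1r; field; rewrite gt_eqF.
  by apply: abel_bound => // n n1; exact: partial_sum_bound.
have -> : \sum_(1 <= n < N.+1) chi n * (t ^+ n / (1 - t ^+ n)) =
   (\sum_(1 <= k < N.+1) chi k / k%:R) / (1 - t) - \sum_(1 <= n < N.+1) chi n * b n.
  rewrite mulr_suml -sumrB; apply: eq_bigr => n _.
  by rewrite /b invfM; ring.
have h2 : (\sum_(1 <= k < N.+1) chi k / k%:R) / (1 - t) <= 2 * D / N.+1%:R / (1 - t).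
  by rewrite ler_wpM2r ?invr_ge0 ?(ltW u0) // (le_trans (ler_norm _)).
rewrite [leRHS]addrC; apply: lerD => //.
by move: h1; rewrite ler_norml => /andP[h _]; rewrite lerNl.
Qed.

(** The Lambert identity truncated at N. Cutting the geometric series of d at [N %/ d] loses at most
    t^N / (1 - t), as d times [(N %/ d).+1] exceeds N; there are N such losses. *)
Lemma divisor_char_power_sum N : (0 < N)%N ->
  \sum_(1 <= M < N.+1) A M * t ^+ M <=
  2 * D + 2 * D / N.+1%:R / (1 - t) + N%:R * t ^+ N / (1 - t).
Proof.
move=> N0; have [t0 t1] := andP t01; have u0 : 0 < 1 - t by rewrite subr_gt0.
have -> : \sum_(1 <= M < N.+1) A M * t ^+ M =
   \sum_(1 <= d < N.+1) \sum_(1 <= k < (N %/ d).+1) chi d * t ^+ (d * k).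
  rewrite sum_divisors_exchange; apply: eq_big_nat => M /andP[M0 _].
  rewrite /A mulr_suml; apply: eq_bigr => d dM; by rewrite mulnC divnK.
apply: (@le_trans _ _ (\sum_(1 <= n < N.+1) chi n * (t ^+ n / (1 - t ^+ n)) +
   \sum_(1 <= n < N.+1) t ^+ N / (1 - t))); last first.
  by apply: lerD; [exact: lambert_bound | rewrite sumr_const_nat subn1 /= -[leLHS]mulr_natl mulrA].
rewrite -big_split /=; apply: ler_sum_nat => d /andP[d0 dN].
have td := tn_lt1 d0.
have -> : \sum_(1 <= k < (N %/ d).+1) chi d * t ^+ (d * k) =
   chi d * ((t ^+ d - t ^+ (d * (N %/ d).+1)) / (1 - t ^+ d)).
  rewrite -mulr_sumr; congr (_ * _); apply: (mulIf (lt0r_neq0 td)).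
  rewrite divfK ?gt_eqF // mulrC.
  elim: (N %/ d)%N => [|q IH]; first by rewrite big_geq // mulr0 muln1 subrr.
  by rewrite big_nat_recr //= mulrDr IH [(d * q.+2)%N]mulnS exprD; ring.
have c1 : `|chi d| <= 1 by case: (chi_val d) => ->; rewrite ?normr0 ?normrN ?normr1.
have x0 : 0 <= t ^+ (d * (N %/ d).+1) / (1 - t ^+ d).
  by rewrite divr_ge0 ?tX_ge0 ?(ltW td).
have x1 : t ^+ (d * (N %/ d).+1) / (1 - t ^+ d) <= t ^+ N / (1 - t).
  apply: ler_pM; rewrite ?tX_ge0 ?invr_ge0 ?(ltW td) ?(ltW t0) //.
    apply: ler_wiXn2l; rewrite ?(ltW t0) ?(ltW t1) //.
    by rewrite mulnC ltnW // ltn_ceil.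
  rewrite lef_pV2 ?posrE // lerD2l lerN2.
  by rewrite -[leRHS]expr1; apply: ler_wiXn2l; rewrite ?(ltW t0) ?(ltW t1).
rewrite mulrBl mulrBr lerD2l.
by move: c1; rewrite ler_norml => /andP[c1 c2]; nra.
Qed.

Let A_ge0 M : (0 < M)%N -> 0 <= A M * t ^+ M.
Proof.
have [t0 _] := andP t01 => M0; rewrite mulr_ge0 ?tX_ge0 //.
by case: (divisor_char_sum M0).
Qed.

Let square_sum_ge J : J%:R * t ^+ (J ^ 2) <= \sum_(1 <= M < (J ^ 2).+1) A M * t ^+ M.
Proof.
have [t0 t1] := andP t01.
elim: J => [|J IH]; first by rewrite mul0r big_geq.
have lJ : (J ^ 2 < J.+1 ^ 2)%N by rewrite ltn_exp2r.
have j0 : (0 < J.+1 ^ 2)%N by rewrite expn_gt0.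
rewrite big_nat_recr //= -[J.+1 in leLHS]addn1 natrD mulrDl mul1r addn1.
apply: lerD; last first.
  rewrite ler_peMl ?tX_ge0 //.
  by case: (divisor_char_sum j0) => _; apply.
rewrite (big_cat_nat _ (n := (J ^ 2).+1)) //=.
rewrite -[leLHS]addr0; apply: lerD; last first.
  by rewrite big_nat_cond sumr_ge0 // => i /andP[/andP[i0 _] _]; apply: A_ge0; lia.
apply: le_trans IH; apply: ler_wpM2l => //.
by apply: ler_wiXn2l; rewrite ?(ltW t0) ?(ltW t1) // ltnW.
Qed.

(** The J squares up to J^2 contribute at least t^(J^2) each, and N tends to infinity: both error
    terms of [divisor_char_power_sum] are O(1/N), because N s^N <= 1/(1 - s) bounds N t^N by a
    multiple of 1/N. *)
Lemma square_sum_bound J : J%:R * t ^+ (J ^ 2) <= 2 * D.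
Proof.
have [t0 t1] := andP t01; have [s0 s1] := andP s01; have u0 : 0 < 1 - t by rewrite subr_gt0.
have v0 : 0 < 1 - s by rewrite subr_gt0.
have D0 : 0 <= D by apply: le_trans (chi_sum 0).
apply/ler_addgt0Pr => e e0.
set C := 2 * D / (1 - t) + ((1 - s) ^+ 2)^-1 / (1 - t).
have C0 : 0 <= C by rewrite /C addr_ge0 // divr_ge0 ?(ltW u0) ?mulr_ge0 // invr_ge0 exprn_ge0
  // ltW.
have [N JN eN] : exists2 N, (J ^ 2 < N)%N & (Num.truncn (C / e) < N)%N.
  by exists (J ^ 2 + Num.truncn (C / e)).+1; rewrite ltnS ?leq_addr ?leq_addl.
have NC : C / N%:R <= e.
  rewrite ler_pdivrMr ?ltr0n //; last by apply: leq_ltn_trans JN.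
  rewrite -ler_pdivrMl // mulrC ltW //.
  by apply: lt_le_trans (truncnS_gt _) _; rewrite ler_nat.
have N0' : (0 < N)%N by apply: leq_ltn_trans JN.
have N0 : 0 < (N%:R : R) by rewrite ltr0n.
apply: (@le_trans _ _ (\sum_(1 <= M < N.+1) A M * t ^+ M)).
  apply: le_trans (square_sum_ge J) _.
  rewrite [leRHS](big_cat_nat _ (n := (J ^ 2).+1)) //=; last exact: ltnW.
  rewrite lerDl big_nat_cond sumr_ge0 // => i /andP[/andP[i0 _] _]; apply: A_ge0.
  by apply: leq_ltn_trans i0.
apply: le_trans (divisor_char_power_sum N0') _; rewrite -addrA lerD2l.
apply: le_trans NC.
have h1 : N%:R * s ^+ N <= (1 - s)^-1.
  have h : 0 <= s ^+ N by rewrite exprn_ge0 // ltW.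
  rewrite -(ler_pM2l v0) mulfV ?gt_eqF //.
  apply: le_trans (ler_wpM2l (ltW v0) (geo_ge N s01)) _.
  by rewrite geoE lerBlDr lerDl.
have h2 : N%:R * t ^+ N <= ((1 - s) ^+ 2)^-1 / N%:R.
  rewrite ler_pdivlMr // /t -exprM mulnC exprM.
  have -> : N%:R * (s ^+ N) ^+ 2 * N%:R = (N%:R * s ^+ N) ^+ 2 by ring.
  have p1 : 0 <= N%:R * s ^+ N by rewrite mulr_ge0 // exprn_ge0 // ltW.
  by rewrite -exprVn; apply: lerXn2r; rewrite ?nnegrE ?invr_ge0 ?(ltW v0).
have h3 : (N.+1%:R : R)^-1 <= N%:R^-1 by rewrite lef_pV2 ?posrE ?ltr0n // ler_nat.
rewrite /C [leRHS]mulrDl; apply: lerD; rewrite [leRHS]mulrAC ler_wpM2r ?invr_ge0 ?(ltW u0) //.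
by apply: ler_wpM2l => //; rewrite mulr_ge0.
Qed.

End Lambert.

Lemma real_char_contradiction : False.
Proof.
have D0 : 0 <= D by apply: le_trans (chi_sum 0).
pose J := (Num.truncn (4 * D)).+1.
have JD : 4 * D < J%:R by exact: truncnS_gt.
have J0 : 0 < (J%:R : R) by rewrite ltr0n.
(* For s = 1 - e Bernoulli's inequality gives t^(J^2) = s^(2 J^2) >= 1/2, so [square_sum_bound]
   yields J <= 4D against the choice of [J]. *)
pose e : R := (4 * J%:R ^+ 2)^-1.
have e0 : 0 < e by rewrite invr_gt0 mulr_gt0 // exprn_gt0.
have J1 : 1 <= (J%:R : R) by rewrite ler1n.
have e1 : e <= 4^-1 by rewrite lef_pV2 ?posrE ?mulr_gt0 ?exprn_gt0 // ler_peMr // exprn_ege1.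
have bern k : 1 - k%:R * e <= (1 - e) ^+ k.
  elim: k => [|k IH]; first by rewrite mul0r subr0 expr0.
  rewrite exprS -[k.+1]addn1 natrD.
  have k0 : 0 <= (k%:R : R) by [].
  have : 0 <= k%:R * e * e by rewrite !mulr_ge0 // ltW.
  have := ler_wpM2l (_ : 0 <= 1 - e) IH; have -> : 0 <= 1 - e by lra.
  move=> /(_ isT); lra.
have s01 : 0 < 1 - e < 1 by apply/andP; split; lra.
have := square_sum_bound s01 J; rewrite -exprM.
have := bern (2 * J ^ 2)%N; rewrite natrM natrX.
have -> : 2 * J%:R ^+ 2 * e = 2^-1 by rewrite /e; field; rewrite gt_eqF.
set x := (1 - e) ^+ _; nra.
Qed.

End RealCharacter.

(** * Logarithmic densities along an ultrafilter *)

Section UltraLimit.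
Variables (R : realType) (U : set_system nat).
Hypothesis UU : UltraFilter U.
Hypothesis Uoo : \oo `<=` U.
Implicit Types u v : nat -> R.

Definition ulim u : R := lim (u n @[n --> U]).

(** The image ultrafilter lives on a compact segment, hence has a cluster point, and an ultrafilter
    converges to each of its cluster points. *)
Lemma ulim_cvg u B : (forall n, `|u n| <= B) -> u n @[n --> U] --> ulim u.
Proof.
move=> uB; suff [l ul] : exists l : R, u n @[n --> U] --> l.
  have h : cvg (u n @[n --> U]) by apply/cvg_ex; exists l.
  exact: h.
have [|p [_ pc]] := @segment_compact R (- B) B (u n @[n --> U]).
  have h : U (u @^-1` [set` `[- B, B]]); last exact: h.
  have : U setT by exact: filterT.
  by apply: filterS => n _; rewrite /= in_itv /= -ler_norml; exact: uB.
exists p => V Vp; have [//|UV] := in_ultra_setVsetC (u @^-1` V) UU.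
by have [x [xV /= nxV]] := pc (~` V) V UV Vp.
Qed.

Lemma ulim_eq u l : u n @[n --> U] --> l -> ulim u = l.
Proof. by move=> ul; apply: cvg_lim => //; exact: Rhausdorff. Qed.

Lemma near_ultra (P : set nat) : (\forall n \near \oo, P n) -> U P.
Proof. exact: Uoo. Qed.

Lemma ulim_cvg_seq u l : u n @[n --> \oo] --> l -> ulim u = l.
Proof. by move=> ul; apply: ulim_eq; apply: cvg_trans ul => A; exact: near_ultra. Qed.

Lemma ulim_le u v B n0 : (forall n, `|u n| <= B) -> (forall n, `|v n| <= B) ->
  (forall n, (n0 <= n)%N -> u n <= v n) -> ulim u <= ulim v.
Proof.
move=> uB vB uv; apply: (ler_cvg_to (ulim_cvg uB) (ulim_cvg vB)).
by apply: near_ultra; exists n0.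
Qed.

Lemma lnn_cvg : (ln n%:R : R) @[n --> \oo] --> +oo.
Proof.
apply/cvgryPge => A; exists (Num.truncn (expR A)).+1 => // n /= nA.
rewrite -[A]expRK ler_ln ?posrE ?expR_gt0 ?ltr0n //; last by lia.
by rewrite ltW // (lt_le_trans (truncnS_gt _)) // ler_nat.
Qed.

Lemma ulim_div_ln u C : (forall n, (1 < n)%N -> `|u n| <= C / ln n%:R) -> ulim u = 0.
Proof.
move=> uC; apply: ulim_cvg_seq.
have c0 : C / ln n%:R @[n --> \oo] --> (0 : R).
  rewrite -(mulr0 C); apply: cvgMl_tmp; apply/gtr0_cvgV0; last exact: lnn_cvg.
  by exists 2%N => // n /= n2; rewrite ln_gt0 // ltr1n.
apply/norm_cvg0P; apply: (squeeze_cvgr _ (cvg_cst 0) c0).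
by exists 2%N => // n /= n2; rewrite normr_ge0 uC.
Qed.

Lemma norm_vonMangoldt_sum (f : nat -> R) B n : (0 < n)%N -> (forall d, `|f d| <= B) ->
  `|\sum_(1 <= d < n.+1) f d * (vonMangoldt R d / d%:R)| <= B * (ln n%:R + 4).
Proof.
move=> n0 fB; have B0 : 0 <= B := le_trans (normr_ge0 _) (fB 0%N).
apply: le_trans (ler_norm_sum _ _ _) _.
apply: le_trans (ler_wpM2l B0 (mertens_upper R n0)).
rewrite mulr_sumr; apply: ler_sum => d _.
rewrite normrM [`|_ / _|]ger0_norm ?divr_ge0 ?vonMangoldt_ge0 //.
by rewrite ler_wpM2r // divr_ge0 ?vonMangoldt_ge0.
Qed.

Definition log_mean (f : nat -> R) n : R :=
  (\sum_(1 <= d < n.+1) f d * (vonMangoldt R d / d%:R)) / ln n%:R.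

Definition log_density (f : nat -> R) : R := ulim (log_mean f).

Let bounded (f : nat -> R) := exists B, forall n, `|f n| <= B.

(** From (ln n + 4) / ln n <= 9, as ln n >= 1/2 for n >= 2. For n <= 1 the logarithm is 0 and so is
    the quotient. *)
Lemma log_mean_bound f B n : (forall d, `|f d| <= B) -> `|log_mean f n| <= 9 * B.
Proof.
move=> fB; have B0 : 0 <= B := le_trans (normr_ge0 _) (fB 0%N).
have [n1|n2] := leqP n 1.
  rewrite /log_mean.
  have -> : ln (n%:R : R) = 0 by case: n n1 => [|[|]] // _; [rewrite ln0 | rewrite ln1].
  by rewrite invr0 mulr0 normr0 mulr_ge0.
have ln2 : (2^-1 : R) <= ln n%:R.
  apply: (@le_trans _ _ (ln 2)); last by rewrite ler_ln ?posrE ?ltr0n ?ler_nat //; lia.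
  have := @ln_le_subr1 R 2^-1; rewrite invr_gt0 ltr0n => /(_ isT).
  rewrite lnV ?posrE ?ltr0n //; lra.
have l0 : 0 < ln (n%:R : R) by apply: lt_le_trans ln2; rewrite invr_gt0.
rewrite /log_mean normrM normfV (gtr0_norm l0) ler_pdivrMr //.
have n0 : (0 < n)%N by lia.
by have := norm_vonMangoldt_sum n0 fB; nra.
Qed.

Lemma log_density_cvg f : bounded f -> log_mean f n @[n --> U] --> log_density f.
Proof. by case=> B fB; apply: (@ulim_cvg _ (9 * B)) => n; exact: log_mean_bound. Qed.

Lemma log_densityD f g : bounded f -> bounded g ->
  log_density (fun n => f n + g n) = log_density f + log_density g.
Proof.
move=> bf bg; apply: ulim_eq.
apply: cvg_trans (cvgD (log_density_cvg bf) (log_density_cvg bg)).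
apply: near_eq_cvg; apply: near_ultra; exists 0%N => // n _ /=.
change (log_mean f n + log_mean g n = log_mean (fun n => f n + g n) n).
rewrite /log_mean -mulrDl -big_split /=; congr (_ / _).
by apply: eq_bigr => d _; rewrite mulrDl.
Qed.

Lemma log_densityZ c f : bounded f ->
  log_density (fun n => c * f n) = c * log_density f.
Proof.
move=> bf; apply: ulim_eq.
apply: cvg_trans (@cvgMl_tmp _ _ _ _ _ c _ (log_density_cvg bf)).
apply: near_eq_cvg; apply: near_ultra; exists 0%N => // n _ /=.
rewrite /log_mean [LHS]mulrA mulr_sumr; congr (_ / _).
by apply: eq_bigr => d _; rewrite -[RHS]mulrA.
Qed.

Lemma log_density_le f g : bounded f -> bounded g -> (forall n, f n <= g n) ->
  log_density f <= log_density g.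
Proof.
move=> [B fB] [C gC] fg.
apply: (@ulim_le _ _ (9 * Num.max B C) 0) => [n|n|n _].
- by apply: log_mean_bound => d; rewrite le_max fB.
- by apply: log_mean_bound => d; rewrite le_max gC orbT.
rewrite /log_mean ler_wpM2r ?invr_ge0 ?lnn_ge0 //; apply: ler_sum => d _.
by rewrite ler_wpM2r // divr_ge0 ?vonMangoldt_ge0.
Qed.

Lemma log_density1 : log_density (fun=> 1) = 1.
Proof.
have b1 : bounded (fun=> 1) by exists 1 => n; rewrite normr1.
apply/eqP; rewrite -subr_eq0; apply/eqP.
have -> : log_density (fun=> 1) - 1 = ulim (fun n => log_mean (fun=> 1) n - 1).
  by apply/esym/ulim_eq; apply: cvgB; [exact: log_density_cvg | exact: cvg_cst].
apply: (@ulim_div_ln _ 4) => n n1.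
have l0 : 0 < ln (n%:R : R) by rewrite ln_gt0 // ltr1n.
rewrite /log_mean -[X in _ - X](divff (lt0r_neq0 l0)) -mulrBl normrM normfV (gtr0_norm l0).
rewrite ler_wpM2r ?invr_ge0 ?(ltW l0) //.
have -> : \sum_(1 <= d < n.+1) 1 * (vonMangoldt R d / d%:R) =
   \sum_(1 <= d < n.+1) vonMangoldt R d / d%:R by apply: eq_bigr => d _; rewrite mul1r.
have n0 : (0 < n)%N by lia.
have := mertens_upper R n0; have := mertens_lower R n0.
by move=> h1 h2; rewrite ler_norml; apply/andP; split; lra.
Qed.

Lemma log_density_norm f B : (forall n, `|f n| <= B) -> `|log_density f| <= B.
Proof.
move=> fB; have bf : bounded f by exists B.
have b1 : bounded (fun=> 1) by exists 1 => n; rewrite normr1.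
have bB c : bounded (fun=> c * 1) by exists `|c * 1|.
have h c : log_density (fun=> c * 1) = c by rewrite log_densityZ // log_density1 mulr1.
by rewrite ler_norml -{1}[- B]h -[X in _ && (_ <= X)]h; apply/andP; split;
  apply: log_density_le => // n; rewrite mulr1; have := fB n; rewrite ler_norml => /andP[].
Qed.

Lemma log_density_sum (I : Type) (r : seq I) (F : I -> nat -> R) :
  (forall i, bounded (F i)) ->
  log_density (fun n => \sum_(i <- r) F i n) = \sum_(i <- r) log_density (F i).
Proof.
move=> bF; suff [] : bounded (fun n => \sum_(i <- r) F i n) /\
  log_density (fun n => \sum_(i <- r) F i n) = \sum_(i <- r) log_density (F i) by [].
elim: r => [|i r [[B IH1] IH2]].
  have -> : (fun n => \sum_(i <- [::]) F i n) = (fun=> 0) by apply/funext => n; rewrite big_nil.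
  have b0 : forall n : nat, `|0 : R| <= 0 by move=> _; rewrite normr0.
  split; first by exists 0.
  by rewrite big_nil; apply/eqP; rewrite -normr_le0; exact: log_density_norm.
have -> : (fun n => \sum_(j <- i :: r) F j n) = (fun n => F i n + \sum_(j <- r) F j n).
  by apply/funext => n; rewrite big_cons.
have [C FC] := bF i.
split.
  exists (C + B) => n; apply: le_trans (ler_normD _ _) _; apply: lerD; [exact: FC|exact: IH1].
by rewrite big_cons log_densityD ?IH2 //; exists B.
Qed.

End UltraLimit.

(** * The operator A and the identity A^2 = -A *)

Section Transfer.
Variables (R : realType) (U : set_system nat).
Hypothesis UU : UltraFilter U.
Hypothesis Uoo : \oo `<=` U.
Implicit Types f : nat -> R.

(** The bound is uniform over all dilations, coprime to the modulus or not, since [log_transfer]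
    averages dilates; this makes the class stable under it with the same [D]. *)
Definition balanced f D := forall g N, `|\sum_(0 <= i < N) f (g * i)%N| <= D.

Lemma balanced_bound f D n : balanced f D -> `|f n| <= 2 * D.
Proof.
move=> fD; have := @partial_sum_bound R (fun i => f (n * i)%N) D 1 2 isT (fD n).
by rewrite big_nat1 muln1.
Qed.

Lemma balanced_dilate f D g : balanced f D -> balanced (fun n => f (g * n)%N) D.
Proof. by move=> fD h N; under eq_bigr do rewrite mulnA; exact: fD. Qed.

Definition log_transfer f (g : nat) : R := log_density U (fun n => f (g * n)%N).

Definition harmonic_sum f : R := ulim U (fun n => \sum_(1 <= k < n.+1) f k / k%:R).

Lemma log_transfer_balanced f D : balanced f D -> balanced (log_transfer f) D.
Proof.
move=> fD g N; rewrite /log_transfer -log_density_sum //; last first.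
  by move=> i; exists (2 * D) => n; exact: balanced_bound.
apply: log_density_norm => // n.
by under eq_bigr do rewrite mulnAC; exact: fD.
Qed.

Lemma harmonic_partial_bound f D n : balanced f D ->
  `|\sum_(1 <= k < n.+1) f k / k%:R| <= 2 * D.
Proof.
move=> fD; rewrite -[leRHS]divr1; apply: harmonic_tail_bound => // N.
by have := fD 1%N N; under eq_bigr do rewrite mul1n.
Qed.

Lemma harmonic_sum_tail f D n : balanced f D ->
  `|\sum_(1 <= k < n.+1) f k / k%:R - harmonic_sum f| <= 2 * D / n.+1%:R.
Proof.
move=> fD; have c := ulim_cvg UU (fun N => harmonic_partial_bound N fD).
have c' := cvg_norm (cvgB (@cvg_cst R (\sum_(1 <= k < n.+1) f k / k%:R) nat U _) c).
have h := @ler_cvg_to nat U _ R _ _ _ _ (c' _ _ _) (@cvg_cst R (2 * D / n.+1%:R) nat U _).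
apply: h; apply: (near_ultra Uoo); exists n => // N /= nN.
change (`|\sum_(1 <= k < n.+1) f k / k%:R - \sum_(1 <= k < N.+1) f k / k%:R| <= 2 * D / n.+1%:R).
rewrite distrC [X in X - _](big_cat_nat _ (n := n.+1)) //= addrAC subrr add0r.
by apply: harmonic_tail_bound => // M; have := fD 1%N M; under eq_bigr do rewrite mul1n.
Qed.

(** If the inner sums are cut at k <= n/d, the double sum equals the sum of f(N) ln N / N, bounded
    by 6D. Each cut costs at most 2D d/n; weighted by the von Mangoldt function over d, this totals
    2D psi(n) / n <= 8D. So the numerator is at most 14D and division by ln n kills it. *)
Lemma log_density_harmonic f D : balanced f D ->
  log_density U (fun d => harmonic_sum (fun k => f (d * k)%N)) = 0.
Proof.
move=> fD; apply: (@ulim_div_ln _ _ UU Uoo _ (14 * D)) => n n1.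
have D0 : 0 <= D := le_trans (normr_ge0 _) (fD 0%N 0%N).
have l0 : 0 < ln (n%:R : R) by rewrite ln_gt0 // ltr1n.
have n0 : 0 < (n%:R : R) by rewrite ltr0n; lia.
rewrite /log_mean normrM normfV (gtr0_norm l0) ler_wpM2r ?invr_ge0 ?(ltW l0) //.
pose H d := harmonic_sum (fun k => f (d * k)%N).
pose T d := \sum_(1 <= k < (n %/ d).+1) f (d * k)%N / k%:R.
have h1 : `|\sum_(1 <= d < n.+1) T d * (vonMangoldt R d / d%:R)| <= 6 * D.
  have -> : \sum_(1 <= d < n.+1) T d * (vonMangoldt R d / d%:R) =
    \sum_(1 <= N < n.+1) f N / N%:R * ln N%:R.
    rewrite -(@sum_ln_convolution _ (fun N => f N / N%:R)).
    apply: eq_big_nat => d /andP[d0 _]; rewrite mulrC -mulrA; congr (_ * _).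
    rewrite mulr_sumr; apply: eq_bigr => k _.
    by rewrite natrM invfM mulrCA.
  have -> : \sum_(1 <= N < n.+1) f N / N%:R * ln N%:R =
     \sum_(1 <= k < n.+1) f k * (ln k%:R / k%:R).
    by apply: eq_bigr => k _; rewrite mulrAC mulrA.
  by apply: ln_harmonic_bound => N; have := fD 1%N N; under eq_bigr do rewrite mul1n.
have h2 : `|\sum_(1 <= d < n.+1) (H d - T d) * (vonMangoldt R d / d%:R)| <= 8 * D.
  apply: (@le_trans _ _ (\sum_(1 <= d < n.+1) 2 * D / n%:R * vonMangoldt R d)).
    apply: le_trans (ler_norm_sum _ _ _) _.
    apply: ler_sum_nat => d /andP[d0 _].
    have d0' : 0 < (d%:R : R) by rewrite ltr0n.
    rewrite normrM [`|_ / _|]ger0_norm ?divr_ge0 ?vonMangoldt_ge0 //.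
    rewrite [_ / d%:R]mulrC mulrA ler_wpM2r ?vonMangoldt_ge0 //.
    rewrite ler_pdivrMr //.
    have := @harmonic_sum_tail _ D (n %/ d) (balanced_dilate d fD).
    rewrite distrC => h; apply: le_trans h _.
    rewrite -[leRHS]mulrA; apply: ler_wpM2l; first by rewrite mulr_ge0.
    rewrite mulrC ler_pdivlMr // mulrC ler_pdivrMr ?ltr0n //.
    by rewrite -natrM ler_nat mulnC ltnW // ltn_ceil.
  rewrite -mulr_sumr.
  have := chebyshev_psi_le R n; rewrite /chebyshev_psi => h.
  apply: (@le_trans _ _ (2 * D / n%:R * (4 * n%:R))).
    by apply: ler_wpM2l => //; rewrite divr_ge0 ?mulr_ge0 // ltW.
  by rewrite le_eqVlt; apply/orP; left; apply/eqP; field; rewrite gt_eqF.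
have -> : \sum_(1 <= d < n.+1) H d * (vonMangoldt R d / d%:R) =
  \sum_(1 <= d < n.+1) T d * (vonMangoldt R d / d%:R) +
  \sum_(1 <= d < n.+1) (H d - T d) * (vonMangoldt R d / d%:R).
  by rewrite -big_split; apply: eq_bigr => d _ /=; ring.
by apply: le_trans (ler_normD _ _) _; lra.
Qed.

(** The density may be exchanged with the infinite harmonic sum because the tails are bounded
    uniformly in the dilation; [log_density_harmonic] then applies. *)
Lemma harmonic_sum_transfer f D : balanced f D -> harmonic_sum (log_transfer f) = 0.
Proof.
move=> fD; have D0 : 0 <= D := le_trans (normr_ge0 _) (fD 0%N 0%N).
rewrite -(log_density_harmonic fD); set l := log_density _ _.
apply: (ulim_cvg_seq UU Uoo).
have bf i : exists B, forall n, `|(f (i * n)%N : R)| <= B.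
  by exists (2 * D) => n; exact: balanced_bound.
apply/cvgrPdist_le => e e0.
exists (Num.truncn (2 * D / e)) => // n /= Dn.
pose H d := harmonic_sum (fun k => f (d * k)%N).
pose S d := \sum_(1 <= k < n.+1) k%:R^-1 * f (k * d)%N.
have SH d : `|S d - H d| <= e.
  have := @harmonic_sum_tail _ D n (balanced_dilate d fD).
  have -> : \sum_(1 <= k < n.+1) f (d * k)%N / k%:R = S d.
    by apply: eq_bigr => k _; rewrite mulrC mulnC.
  move=> h; apply: le_trans h _.
  rewrite ler_pdivrMr ?ltr0n // -ler_pdivrMl // mulrC ltW //.
  apply: lt_le_trans (truncnS_gt _) _; by rewrite ler_nat ltnS.
have Sb k : exists B, forall d, `|k%:R^-1 * f (k * d)%N| <= B.
  exists (k%:R^-1 * (2 * D)) => d; rewrite normrM ger0_norm ?invr_ge0 //.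
  by rewrite ler_wpM2l ?invr_ge0 // balanced_bound.
have -> : \sum_(1 <= k < n.+1) log_transfer f k / k%:R = log_density U S.
  rewrite log_density_sum //; apply: eq_bigr => k _.
  by rewrite log_densityZ // mulrC.
have bS : exists B, forall d, `|S d| <= B.
  exists (2 * D) => d; have := harmonic_partial_bound n (balanced_dilate d fD).
  by under eq_bigr do rewrite mulrC mulnC.
have bH : exists B, forall d, `|H d| <= B.
  have [B SB] := bS; exists (e + B) => d.
  rewrite -[H d](subrK (S d)); apply: le_trans (ler_normD _ _) _.
  by apply: lerD; rewrite // distrC.
have -> : l = log_density U H by [].
rewrite distrC -mulN1r -log_densityZ // -log_densityD //; last first.
  by have [B HB] := bH; exists B => d; rewrite mulN1r normrN.
by apply: log_density_norm => // d; rewrite mulN1r.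
Qed.

(** In [moebius_vonMangoldt] for f(N)/N the inner sums are minus tails of vanishing series, hence at
    most 2D/n. The weights ln n - ln d add up to n ln n - ln n! <= n, so the sum of f(d) against the
    weights of [log_mean] is -f(1) ln n up to 2D. *)
Lemma log_density_of_harmonic0 f D : balanced f D ->
  (forall g, harmonic_sum (fun k => f (g * k)%N) = 0) -> log_density U f = - f 1%N.
Proof.
move=> fD H0; have D0 : 0 <= D := le_trans (normr_ge0 _) (fD 0%N 0%N).
have bf : exists B, forall n, `|f n| <= B by exists (2 * D) => n; exact: balanced_bound.
apply/eqP; rewrite -subr_eq0 opprK; apply/eqP.
have -> : log_density U f + f 1%N = ulim U (fun n => log_mean f n + f 1%N).
  by apply/esym/ulim_eq => //; apply: cvgD; [exact: log_density_cvg | exact: cvg_cst].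
apply: (@ulim_div_ln _ _ UU Uoo _ (2 * D)) => n n1.
have l0 : 0 < ln (n%:R : R) by rewrite ln_gt0 // ltr1n.
have n0 : (0 < n)%N by lia.
have n0' : 0 < (n%:R : R) by rewrite ltr0n.
rewrite -[f 1%N](mulfK (lt0r_neq0 l0)) /log_mean -mulrDl normrM normfV (gtr0_norm l0).
rewrite ler_wpM2r ?invr_ge0 ?(ltW l0) // addrC.
have := @moebius_vonMangoldt R (fun N => f N / N%:R) n n0.
rewrite divr1.
have -> : \sum_(1 <= N < n.+1) f N / N%:R * vonMangoldt R N =
  \sum_(1 <= d < n.+1) f d * (vonMangoldt R d / d%:R).
  by apply: eq_bigr => d _; rewrite mulrAC mulrA.
move=> <-.
apply: (@le_trans _ _ (\sum_(1 <= d < n.+1) (ln n%:R - ln d%:R) * (2 * D / n%:R))).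
  apply: le_trans (ler_norm_sum _ _ _) _.
  apply: ler_sum_nat => d /andP[d0 dn].
  have d0' : 0 < (d%:R : R) by rewrite ltr0n.
  have ld : 0 <= ln n%:R - ln (d%:R : R) by rewrite subr_ge0 ler_ln ?posrE // ler_nat; lia.
  rewrite normrM; apply: ler_pM => //.
    rewrite normrM (ger0_norm ld) ler_piMl //; exact: moebius_norm.
  have -> : \sum_(1 <= k < (n %/ d).+1) f (d * k)%N / (d * k)%:R =
     d%:R^-1 * \sum_(1 <= k < (n %/ d).+1) f (d * k)%N / k%:R.
    by rewrite mulr_sumr; apply: eq_bigr => k _; rewrite natrM invfM mulrCA.
  have := @harmonic_sum_tail _ D (n %/ d) (balanced_dilate d fD).
  rewrite H0 subr0 => h; rewrite normrM ger0_norm ?invr_ge0 ?(ltW d0') //.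
  rewrite mulrC ler_pdivrMr //; apply: le_trans h _.
  rewrite -[leRHS]mulrA; apply: ler_wpM2l; first by rewrite mulr_ge0.
  rewrite mulrC ler_pdivlMr // mulrC ler_pdivrMr ?ltr0n //.
  by rewrite -natrM ler_nat mulnC ltnW // ltn_ceil.
rewrite -mulr_suml sumrB sumr_const_nat subn1 /= -[X in (X - _) * _]mulr_natl.
have -> : \sum_(1 <= d < n.+1) ln (d%:R : R) = ln n`!%:R.
  by rewrite fact_prod !big_add1 ln_prodn.
have := ln_fact_ge R n => h.
rewrite [leRHS](_ : _ = n%:R * (2 * D / n%:R)); last by field; rewrite gt_eqF.
by apply: ler_wpM2r; [rewrite divr_ge0 ?mulr_ge0 // ltW | lra].
Qed.

Lemma log_transfer_sqr f D g : balanced f D ->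
  log_transfer (log_transfer f) g = - log_transfer f g.
Proof.
move=> fD; have AD := log_transfer_balanced fD.
rewrite {1}/log_transfer (@log_density_of_harmonic0 _ D) ?muln1 //.
  exact: balanced_dilate.
move=> h; rewrite -(@harmonic_sum_transfer (fun n => f (g * (h * n))%N) D).
  congr harmonic_sum; apply/funext => k; rewrite /log_transfer.
  by congr (log_density U); apply/funext => n; rewrite !mulnA.
by move=> k N; under eq_bigr do rewrite !mulnA; exact: fD.
Qed.

End Transfer.

(** * Equidistribution of primes in reduced residue classes *)

Lemma periodic_partial_bound (R : realType) (c : nat -> R) m B N : (0 < m)%N ->
  (forall n, c (n + m)%N = c n) -> (forall n, `|c n| <= B) ->
  \sum_(0 <= i < m) c i = 0 -> `|\sum_(0 <= i < N) c i| <= m%:R * B.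
Proof.
move=> m0 cp cB c0; have B0 : 0 <= B := le_trans (normr_ge0 _) (cB 0%N).
elim/ltn_ind: N => N IH; have [Nm|mN] := leqP N m.
  apply: le_trans (ler_norm_sum _ _ _) _.
  apply: (@le_trans _ _ (\sum_(0 <= i < N) B)); first exact: ler_sum.
  by rewrite sumr_const_nat subn0 -[leLHS]mulr_natl ler_wpM2r // ler_nat.
rewrite (big_cat_nat _ (n := m)) //= ?(ltnW mN) // c0 add0r.
rewrite -{1}[m]add0n big_addn; under eq_bigr do rewrite cp.
by apply: IH; lia.
Qed.

Lemma coprime_inverse g m : (1 < m)%N -> coprime g m -> exists u, (g * u = 1 %[mod m])%N.
Proof.
move=> m1 gm; have [g0|g0] := posnP g.
  by move: gm m1; rewrite g0 /coprime gcd0n => /eqP ->.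
have [[u v] /= uv] := coprimeP _ g0 gm.
exists u; have -> : (g * u = v * m + 1)%N by lia.
by rewrite modnMDl.
Qed.

Section Uniform.
Variables (R : realType) (U : set_system nat) (m : nat).
Hypothesis UU : UltraFilter U.
Hypothesis Uoo : \oo `<=` U.
Hypothesis m1 : (1 < m)%N.
Local Notation phi := ((totient m)%:R : R).
Local Notation sigma := (@log_density R U).
Implicit Types f : nat -> R.

Let m0 : (0 < m)%N. Proof. exact: ltnW. Qed.
Let phi0 : 0 < phi. Proof. by rewrite ltr0n totient_gt0. Qed.

Definition res_ind a n : R := (n == a %[mod m])%N%:R.
Definition cop_ind n : R := (coprime n m)%:R.
Definition class_density a : R := sigma (res_ind a).
Local Notation rho := class_density.

Lemma res_ind_bound a : exists B, forall n, `|res_ind a n| <= B.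
Proof. by exists 1 => n; rewrite /res_ind normr_nat lern1 leq_b1. Qed.

Lemma cop_ind_bound : exists B, forall n, `|cop_ind n| <= B.
Proof. by exists 1 => n; rewrite /cop_ind normr_nat lern1 leq_b1. Qed.

Lemma zero_bound : exists B, forall n : nat, `|0 : R| <= B.
Proof. by exists 0 => n; rewrite normr0. Qed.

Lemma log_density0 : sigma (fun=> 0) = 0.
Proof. by apply/eqP; rewrite -normr_le0; apply: log_density_norm => // n; rewrite normr0. Qed.

Lemma class_density_ge0 a : 0 <= rho a.
Proof.
rewrite -log_density0; apply: log_density_le => //; first exact: zero_bound.
exact: res_ind_bound.
Qed.

Lemma log_density_periodic f : (forall n, f n = f (n %% m)%N) ->
  sigma f = \sum_(0 <= h < m) f h * rho h.
Proof.
move=> fp; transitivity (sigma (fun n => \sum_(0 <= h < m) f h * res_ind h n)).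
  congr log_density; apply/funext => n.
  rewrite (eq_big_nat _ _ (F2 := fun h => if h == (n %% m)%N then f h else 0)).
    by rewrite -big_mkcond sum_nat_single /= ltn_pmod // -fp.
  move=> h /andP[_ hm]; rewrite /res_ind (modn_small hm) eq_sym.
  by case: eqP; rewrite ?mulr1 ?mulr0.
rewrite log_density_sum // => [|h].
  by apply: eq_bigr => h _; rewrite log_densityZ //; exact: res_ind_bound.
by have [B rB] := res_ind_bound h; exists (`|f h| * B) => n; rewrite normrM ler_wpM2l.
Qed.

Lemma log_density_cop : sigma cop_ind = 1.
Proof.
have nb : exists B, forall n, `|1 - cop_ind n| <= B.
  by have [B cB] := cop_ind_bound; exists (1 + B) => n;
     rewrite (le_trans (ler_normB _ _)) // normr1 lerD2l.
have nc0 : sigma (fun n => 1 - cop_ind n) = 0.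
  apply: (@ulim_div_ln _ _ UU Uoo _ (\sum_(1 <= p < m.+1 | prime p) ln p%:R)) => n n1.
  have l0 : 0 < ln (n%:R : R) by rewrite ln_gt0 // ltr1n.
  rewrite /log_mean normrM normfV (gtr0_norm l0) ler_wpM2r ?invr_ge0 ?(ltW l0) //.
  apply: le_trans (sum_noncoprime_bound R n m0).
  rewrite ger0_norm.
    apply: ler_sum => d _; rewrite /cop_ind mulrCA mulrC.
    by case: coprime; rewrite /= ?subrr ?subr0 ?mul0r ?mulr0 // mul1r mulr1 mulrC.
  apply: sumr_ge0 => d _; rewrite mulr_ge0 // ?divr_ge0 ?vonMangoldt_ge0 //.
  by rewrite /cop_ind; case: coprime; rewrite /= ?subrr ?subr0.
have one_b : exists B, forall n : nat, `|1 : R| <= B by exists 1 => n; rewrite normr1.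
have : sigma (fun n => (1 - cop_ind n) + cop_ind n) = sigma (fun=> 1).
  by congr log_density; apply/funext => n; rewrite subrK.
by rewrite log_densityD ?nc0 ?add0r ?log_density1 //; exact: cop_ind_bound.
Qed.

Lemma sum_dilated_res g a : coprime g m ->
  \sum_(0 <= i < m) res_ind a (g * i)%N = 1.
Proof.
move=> gm; have [u gu] := coprime_inverse m1 gm.
rewrite (eq_big_nat _ _ (F2 := fun i => if i == ((u * a) %% m)%N then 1 else 0)).
  by rewrite -big_mkcond sum_nat_single /= ltn_pmod.
move=> i /andP[_ im]; rewrite /res_ind -{2}(modn_small im).
suff -> : (g * i == a %[mod m])%N = (i == u * a %[mod m])%N by case: eqP.
apply/eqP/eqP => [gi|iu].
  rewrite -modnMmr -gi modnMmr mulnA [(u * g)%N]mulnC -modnMml gu modnMml mul1n //.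
by rewrite -modnMmr iu modnMmr mulnA -modnMml gu modnMml mul1n.
Qed.

Definition res_dev a n : R := res_ind a n - phi^-1 * cop_ind n.

(** The sum over a period vanishes: dilation by g coprime to m permutes the residues, and for other
    g both parts of [res_dev] are identically zero, a being coprime to m. *)
Lemma res_dev_balanced a : coprime a m -> exists D, balanced (res_dev a) D.
Proof.
move=> am; exists (m%:R * 2) => g N.
have dev_b n : `|res_dev a n| <= 2.
  apply: le_trans (ler_normB _ _) _; apply: lerD.
    by rewrite /res_ind normr_nat lern1 leq_b1.
  rewrite normrM ger0_norm ?invr_ge0 //; apply: mulr_ile1; rewrite ?invr_ge0 //.
    by rewrite invf_le1 // ler1n totient_gt0.
  by rewrite /cop_ind normr_nat lern1 leq_b1.
apply: periodic_partial_bound => // [n|].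
  rewrite /res_dev /res_ind /cop_ind mulnDr.
  by rewrite [(g * n + g * m)%N]addnC modnMDl -coprime_modl modnMDl coprime_modl.
have [gm|gm] := boolP (coprime g m); last first.
  rewrite big1 // => i _; rewrite /res_dev /cop_ind coprimeMl (negPf gm) mulr0 subr0 /res_ind.
  case: eqP => // h; have := am.
  by rewrite -coprime_modl -h coprime_modl coprimeMl (negPf gm).
rewrite /res_dev sumrB sum_dilated_res // -mulr_sumr.
have -> : \sum_(0 <= i < m) cop_ind (g * i)%N = phi.
  rewrite totient_count_coprime natr_sum; apply: eq_bigr => i _.
  by rewrite /cop_ind coprimeMl gm /= coprime_sym.
by rewrite mulVf ?subrr // gt_eqF.
Qed.

Lemma dev_transfer a n : log_transfer U (res_dev a) n =
  log_transfer U (res_ind a) n - phi^-1 * cop_ind n.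
Proof.
rewrite /log_transfer.
have -> : (fun k => res_dev a (n * k)%N) =
   (fun k => res_ind a (n * k)%N + (- (phi^-1 * cop_ind n)) * cop_ind k).
  apply/funext => k; rewrite /res_dev mulNr -mulrA; congr (_ - _ * _).
  by rewrite /cop_ind coprimeMl; case: coprime; rewrite /= ?mul1r ?mul0r.
rewrite log_densityD //; first by rewrite log_densityZ ?log_density_cop ?mulr1 //;
  exact: cop_ind_bound.
  by have [B rB] := res_ind_bound a; exists B.
have [B cB] := cop_ind_bound; exists (`|phi^-1 * cop_ind n| * B) => k.
by rewrite normrM normrN ler_wpM2l.
Qed.

Lemma res_transfer_periodic a n :
  log_transfer U (res_ind a) n = log_transfer U (res_ind a) (n %% m).
Proof.
by congr log_density; apply/funext => k; rewrite /res_ind modnMml.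
Qed.

Lemma res_transfer_bound a : exists B, forall n, `|log_transfer U (res_ind a) n| <= B.
Proof.
by exists 1 => n; apply: log_density_norm => // k; rewrite /res_ind normr_nat lern1 leq_b1.
Qed.

(** The identity A^2 = -A for [res_dev a], evaluated at 1. The first term is the sum of rho(h)
    rho(k) over hk = a modulo m, so this is an analogue of Selberg's symmetry formula. *)
Lemma density_convolution a : coprime a m ->
  sigma (log_transfer U (res_ind a)) + rho a = 2 / phi.
Proof.
move=> am; have [D dD] := res_dev_balanced am.
have := log_transfer_sqr UU Uoo 1 dD; rewrite dev_transfer.
have -> : log_transfer U (log_transfer U (res_dev a)) 1 =
   sigma (log_transfer U (res_ind a)) - phi^-1.
  rewrite {1}/log_transfer.
  have -> : (fun n => log_transfer U (res_dev a) (1 * n)) =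
     (fun n => log_transfer U (res_ind a) n + (- phi^-1) * cop_ind n).
    by apply/funext => n; rewrite mul1n dev_transfer mulNr.
  rewrite log_densityD //; first by rewrite log_densityZ ?log_density_cop ?mulr1 //;
    exact: cop_ind_bound.
    exact: res_transfer_bound.
  have [B cB] := cop_ind_bound; exists (`|phi^-1| * B) => k.
  by rewrite normrM normrN ler_wpM2l.
have -> : log_transfer U (res_ind a) 1 = rho a.
  by congr log_density; apply/funext => n; rewrite mul1n.
have -> : cop_ind 1 = 1 by rewrite /cop_ind coprime1n.
lra.
Qed.

End Uniform.

Lemma psum_gt0_ex (R : realType) (m : nat) (x : nat -> R) :
  0 < \sum_(0 <= h < m) x h -> exists h, 0 < x h.
Proof.
move=> s0; apply: contrapT => nx; move: s0; apply/negP; rewrite -leNgt.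
by apply: sumr_le0 => h _; rewrite leNgt; apply/negP => xh; apply: nx; exists h.
Qed.

(** * The extremal function is a real character; uniformity of the densities *)

Section Equidistribution.
Variables (R : realType) (U : set_system nat) (m : nat).
Hypothesis UU : UltraFilter U.
Hypothesis Uoo : \oo `<=` U.
Hypothesis m1 : (1 < m)%N.
Local Notation phi := ((totient m)%:R : R).
Local Notation sigma := (@log_density R U).
Local Notation rho := (@class_density R U m).

Let m0 : (0 < m)%N. Proof. exact: ltnW. Qed.
Let phi0 : 0 < phi. Proof. by rewrite ltr0n totient_gt0. Qed.

Section Extremal.
Variable chi : nat -> R.
Hypothesis chip : forall n, chi n = chi (n %% m)%N.
Hypothesis chi_le1 : forall n, `|chi n| <= 1.
Hypothesis chi1 : chi 1%N = 1.
Hypothesis chi0 : forall n, ~~ coprime n m -> chi n = 0.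
Hypothesis chiA : forall g, log_transfer U chi g = - chi g.

Let chi_mod a b : (a = b %[mod m])%N -> chi a = chi b.
Proof. by move=> ab; rewrite chip ab -chip. Qed.

(* 1 + chi(g) chi(g n) is nonnegative in n and its density is
   1 + chi(g) (A chi)(g) = 0, so it vanishes on every class of positive density. *)
Let extremal g h : `|chi g| = 1 -> 0 < rho h -> chi g * chi (g * h)%N = -1.
Proof.
move=> g1 h0; set f := fun n => 1 + chi g * chi (g * n)%N.
have f0 n : 0 <= f n.
  rewrite /f; have : `|chi g * chi (g * n)%N| <= 1 by rewrite normrM g1 mul1r.
  by rewrite ler_norml => /andP[]; lra.
have fb : exists B, forall n, `|f n| <= B.
  exists 2 => n; apply: le_trans (ler_normD _ _) _.
  by rewrite normr1 normrM g1 mul1r; have := chi_le1 (g * n); lra.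
have gg : chi g * chi g = 1 by rewrite -expr2 -real_normK ?num_real // g1 expr1n.
have bchi : exists B, forall n, `|chi (g * n)%N| <= B by exists 1.
have b1 : exists B, forall n : nat, `|1 : R| <= B by exists 1 => n; rewrite normr1.
have bc : exists B, forall n, `|chi g * chi (g * n)%N| <= B.
  by exists 1 => n; rewrite normrM g1 mul1r.
have sf : sigma f = 0.
  rewrite log_densityD // log_densityZ // log_density1 //.
  by rewrite -[sigma _]/(log_transfer U chi g) chiA mulrN gg subrr.
have : f h * rho h <= 0.
  rewrite -sf -log_densityZ //; last exact: res_ind_bound.
  have [B rB] := @res_ind_bound R m h.
  apply: log_density_le => // [|n].
    by exists (`|f h| * B) => n; rewrite normrM ler_wpM2l.
  rewrite /res_ind; case: eqP => [nh|_]; last by rewrite mulr0.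
  rewrite mulr1 /f (@chi_mod (g * n) (g * h)) //.
  by rewrite -modnMmr nh modnMmr.
rewrite pmulr_lle0 // => fh; have := f0 h; rewrite /f in fh *; lra.
Qed.

Let chi_pos h : 0 < rho h -> chi h = -1.
Proof. by move=> h0; have := @extremal 1 h; rewrite chi1 normr1 mul1r mul1n; apply. Qed.

Let pos_coprime h : 0 < rho h -> coprime h m.
Proof.
move=> h0; apply: contrapT => /negP /chi0; rewrite chi_pos //.
by move/eqP; rewrite oppr_eq0 oner_eq0.
Qed.

(** If rho(b) = 0, then [density_convolution] makes the convolution at b equal to 2/phi > 0, so some
    product rho(h) rho(k) with hk = b is positive. *)
Let coprime_cover b : coprime b m ->
  0 < rho b \/ exists h k, [/\ 0 < rho h, 0 < rho k & (b = h * k %[mod m])%N].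
Proof.
move=> bm; have [b0|b0] := ltP 0 (rho b); first by left.
right; have rb : rho b = 0 by apply/eqP; rewrite eq_le b0 class_density_ge0.
have := density_convolution R UU Uoo m1 bm; rewrite rb addr0 => h0.
have : 0 < sigma (log_transfer U (@res_ind R m b)) by rewrite h0 divr_gt0.
rewrite (log_density_periodic UU Uoo m1); last exact: res_transfer_periodic.
case/psum_gt0_ex => h hp; exists h.
have rh : 0 < rho h.
  rewrite lt_neqAle class_density_ge0 // andbT eq_sym; apply: contraTneq hp => ->.
  by rewrite mulr0 ltxx.
move: hp; rewrite pmulr_lgt0 // /log_transfer (log_density_periodic UU Uoo m1); last first.
  by move=> n; rewrite /res_ind modnMmr.
case/psum_gt0_ex => k; rewrite /res_ind; case: eqP => [hk|_]; last by rewrite mul0r ltxx.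
by rewrite mul1r => rk; exists k.
Qed.

Let chi_cop b : coprime b m -> `|chi b| = 1.
Proof.
case/coprime_cover => [b0|[h [k [h0 k0 bhk]]]]; first by rewrite chi_pos // normrN1.
rewrite (chi_mod bhk); have := @extremal h k; rewrite (chi_pos h0) normrN1.
by move=> /(_ erefl k0) e; rewrite (_ : chi (h * k)%N = 1) ?normr1 //; lra.
Qed.

Lemma extremal_val n : [\/ chi n = 0, chi n = 1 | chi n = -1].
Proof.
have [nm|nm] := boolP (coprime n m); last by constructor 1; exact: chi0.
have /eqP := chi_cop nm; rewrite eqr_norml ler01 andbT => /orP[] /eqP ->.
  by constructor 2.
by constructor 3.
Qed.

(** By [extremal], multiplication by a class of positive density changes the sign of chi on reduced
    classes. Every reduced y is such a class or a product of two, so it acts as multiplication by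
    chi(y). *)
Lemma extremalM x y : chi (x * y)%N = chi x * chi y.
Proof.
have [xm|xm] := boolP (coprime x m); last first.
  by rewrite (chi0 xm) mul0r chi0 // coprimeMl (negPf xm).
have [ym|ym] := boolP (coprime y m); last first.
  by rewrite (chi0 ym) mulr0 chi0 // coprimeMl (negPf ym) andbF.
have sq z : coprime z m -> chi z * chi z = 1.
  by move=> zm; rewrite -expr2 -real_normK ?num_real // chi_cop // expr1n.
have step z h : coprime z m -> 0 < rho h -> chi (z * h)%N = - chi z.
  move=> zm h0; have e := extremal (chi_cop zm) h0; have s := sq z zm.
  by rewrite -[LHS]mul1r -s -mulrA e mulrN1.
case: (coprime_cover ym) => [y0|[h [k [h0 k0 yhk]]]].
  by rewrite step // (chi_pos y0) mulrN1.
rewrite (chi_mod yhk) (@chi_mod (x * y) (x * h * k)); last first.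
  by rewrite -modnMmr yhk modnMmr mulnA.
rewrite step ?coprimeMl ?xm ?pos_coprime // step // [chi (h * k)%N]step ?pos_coprime //.
by rewrite (chi_pos h0) !opprK mulr1.
Qed.
End Extremal.

Lemma class_density_uniform a : coprime a m -> rho a = phi^-1.
Proof.
move=> am; apply: contrapT => ra.
have [D dD] := res_dev_balanced R m1 am.
pose f0 := log_transfer U (@res_dev R m a).
have f0p n : f0 n = f0 (n %% m)%N.
  congr log_density; apply/funext => k; rewrite /res_dev /res_ind /cop_ind modnMml.
  by rewrite !coprimeMl coprime_modl.
have f00 n : ~~ coprime n m -> f0 n = 0.
  move=> nm; rewrite /f0 dev_transfer // /cop_ind (negPf nm) mulr0 subr0.
  rewrite /log_transfer -[RHS](log_density0 R UU Uoo); congr log_density; apply/funext => k.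
  rewrite /res_ind; case: eqP => // nk; have := am.
  by rewrite -coprime_modl -nk coprime_modl coprimeMl (negPf nm).
(* Nonuniformity enters here: [f0 1] is the deviation of [rho a] from its expected value. *)
have f01 : f0 1%N != 0.
  rewrite /f0 dev_transfer // /cop_ind coprime1n mulr1 subr_eq0.
  apply/eqP; rewrite /log_transfer; have -> : (fun n => @res_ind R m a (1 * n)) = res_ind R m a.
    by apply/funext => n; rewrite mul1n.
  exact: ra.
have [g0 g0M] : exists g0, forall n, `|f0 n| <= `|f0 g0|.
  have [g0 _ g0M] := @Order.TotalTheory.arg_maxP _ _ _ (Ordinal m0) xpredT (fun i : 'I_m =>
    `|f0 i|) isT.
  exists g0 => n; rewrite f0p.
  by have := g0M (Ordinal (ltn_pmod n m0)) isT.
set c := f0 g0.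
have c0 : c != 0.
  by rewrite -normr_gt0; apply: lt_le_trans (g0M 1%N); rewrite normr_gt0.
(* Dilating and rescaling commute with the transfer, so [chi] is the transfer of [e]. Lying in the
   image gives both A chi = -chi and the vanishing of L(1, chi). *)
pose chi n := c^-1 * f0 (g0 * n)%N.
pose e n := c^-1 * @res_dev R m a (g0 * n)%N.
have eb : balanced e (`|c^-1| * D).
  move=> g N; rewrite /e -mulr_sumr normrM ler_wpM2l //.
  by under eq_bigr do rewrite mulnA; exact: dD.
have bdev g : exists B, forall n, `|@res_dev R m a (g * n)%N| <= B.
  by exists (2 * D) => n; exact: balanced_bound.
have chiE : chi = log_transfer U e.
  apply/funext => n; rewrite /chi /f0 /log_transfer -log_densityZ //.
  by congr log_density; apply/funext => k; rewrite /e mulnA.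
have chiA g : log_transfer U chi g = - chi g by rewrite chiE; exact: log_transfer_sqr eb.
have chib : balanced chi (`|c^-1| * D) by rewrite chiE; exact: log_transfer_balanced.
have chip n : chi n = chi (n %% m)%N.
  by rewrite /chi f0p -modnMmr -f0p.
have chi_le1 n : `|chi n| <= 1.
  by rewrite /chi normrM normfV mulrC ler_pdivrMr ?normr_gt0 // mul1r.
have chi1 : chi 1%N = 1 by rewrite /chi muln1 mulVf.
have chi0 n : ~~ coprime n m -> chi n = 0.
  by move=> nm; rewrite /chi f00 ?mulr0 // coprimeMl negb_and nm orbT.
apply: (@real_char_contradiction R chi (`|c^-1| * D)) => //.
- exact: extremalM.
- exact: extremal_val.
- by move=> n; have := chib 1%N n; under eq_bigr do rewrite mul1n.
- move=> n; have := harmonic_sum_tail UU Uoo n chib.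
  by rewrite [harmonic_sum _ _](_ : _ = 0) ?subr0 // chiE; exact: harmonic_sum_transfer eb.
Qed.
End Equidistribution.

(** * The contradiction *)

(** As 2 #B >= phi + 1, the density #B/phi exceeds 1/2 by at least 1/(2 phi). Asking for 1/(4 phi)
    only makes the inequality strict, so it holds for [log_mean] at some n beyond [n0]. The 2 pays
    for the proper prime powers. *)
Lemma prime_log_density (R : realType) (m : nat) (B : pred nat) n0 : (1 < m)%N ->
  (forall h, B h -> coprime h m) ->
  (totient m < 2 * \sum_(0 <= h < m) B h)%N ->
  exists2 n, (n0 <= n)%N &
   (2^-1 + (4 * (totient m)%:R)^-1) * ln n%:R - 2 <=
   \sum_(1 <= p < n.+1 | prime p) (B (p %% m)%N)%:R * ln (p%:R : R) / p%:R.
Proof.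
move=> m1 Bc Bm; have m0 := ltnW m1.
have phi0 : 0 < ((totient m)%:R : R) by rewrite ltr0n totient_gt0.
have [U [UU Uoo]] := @ultraFilterLemma nat \oo _.
pose f n : R := (B (n %% m)%N)%:R.
have f01 n : 0 <= f n <= 1 by rewrite /f ler0n lern1 leq_b1.
have fb : exists B, forall n, `|f n| <= B.
  by exists 1 => n; rewrite /f normr_nat lern1 leq_b1.
set c : R := 2^-1 + _.
have sf : c < log_density U f.
  rewrite (log_density_periodic UU Uoo m1); last by move=> n; rewrite /f modn_mod.
  have -> : \sum_(0 <= h < m) f h * class_density R U m h =
     (\sum_(0 <= h < m) B h)%N%:R / (totient m)%:R.
    rewrite natr_sum mulr_suml; apply: eq_big_nat => h /andP[_ hm].
    rewrite /f modn_small //; case: (boolP (B h)) => Bh; last by rewrite !mul0r.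
    by rewrite (class_density_uniform R UU Uoo m1) //; exact: Bc.
  rewrite ltr_pdivlMr //.
  have -> : c * (totient m)%:R = 2^-1 * (totient m)%:R + 4^-1.
    by rewrite /c; field; rewrite gt_eqF.
  move: Bm; rewrite -(ler_nat R) -addn1 natrD natrM; lra.
have := log_density_cvg UU fb => /cvgr_gt /(_ _ sf) h1.
have [n [/= cn n0n]] : exists n, (c < log_mean f n /\ (maxn n0 2 <= n)%N).
  have := filter_ex (filterI h1 (Uoo _ (nbhs_infty_ge (maxn n0 2)))); move=> [n [? ?]].
  by exists n.
move: n0n; rewrite geq_max => /andP[n0n n2].
exists n => //; rewrite lerBlDr.
have l0 : 0 < ln (n%:R : R) by rewrite ln_gt0 // ltr1n.
apply: le_trans (sum_prime_powers_bound _ f01).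
move: cn; rewrite /log_mean ltr_pdivlMr // => /ltW cn; apply: le_trans cn _.
by apply: ler_sum => d _; rewrite mulrA mulrAC.
Qed.

Section Contradiction.
Variable R : realType.
Variables (xi a b : int) (m N0 : nat) (B : pred nat).
Hypothesis xi0 : xi != 0.
Hypothesis b0 : b != 0.
Hypothesis FB : forall p, prime p -> B (p %% m)%N -> (N0 < p)%N ->
  euler_series (xi%:~R : Qp p) = a%:~R / b%:~R.

Let form n := a * padeQ xi n - b * padeP xi n.

Lemma pade_form_neq0 n : (form n != 0) || (form n.+1 != 0).
Proof.
rewrite -negb_and; apply/negP => /andP[/eqP e1 /eqP e2].
have : b * (padeQ xi n * padeP xi n.+1 - padeQ xi n.+1 * padeP xi n) =
   padeQ xi n.+1 * form n - padeQ xi n * form n.+1 by rewrite /form; ring.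
rewrite e1 e2 !mulr0 subrr pade_det => /eqP.
by rewrite !mulf_eq0 (negPf b0) expf_eq0 (negPf xi0) andbF orbF pnatr_eq0 expn_eq0 -leqn0
  leqNgt fact_gt0.
Qed.

Lemma pade_form_upper n : form n != 0 -> ln (`|form n|%N%:R : R) <=
  ln (`|a| + `|b|)%N%:R + n%:R * ln (4 * `|xi|)%N%:R + ln n`!%:R.
Proof.
move=> f0; have h : (`|form n| <= (`|a| + `|b|) * ((4 * `|xi|) ^ n * n`!))%N.

  have hQ := padeQ_bound n xi0; have hP := padeP_bound n xi0.
  have : `|form n| <= (`|a| + `|b|) * ((4 * `|xi|) ^+ n * n`!%:R).
    apply: le_trans (ler_normB _ _) _; rewrite !normrM mulrDl.
    by apply: lerD; apply: ler_wpM2l.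

  by rewrite -lez_nat -[(_ * _)%N%:Z]natz natrM natrD natrM natrX natrM !natz !abszE.
have c0 : (0 < `|a| + `|b|)%N by rewrite addn_gt0 orbC absz_gt0 b0.
have x0 : (0 < (4 * `|xi|) ^ n)%N by rewrite expn_gt0 muln_gt0 absz_gt0 xi0.
have : ln (`|form n|%N%:R : R) <= ln ((`|a| + `|b|) * ((4 * `|xi|) ^ n * n`!))%N%:R.
  by rewrite ler_ln ?posrE ?ltr0n ?absz_gt0 // ?ler_nat // !muln_gt0 c0 x0 fact_gt0.
move=> h'; apply: le_trans h' _.
rewrite natrM lnM ?posrE ?ltr0n // ?muln_gt0 ?x0 ?fact_gt0 //.
by rewrite natrM lnM ?posrE ?ltr0n ?fact_gt0 // ln_natX addrA.
Qed.

(** A prime p of B above [N0] divides the form at least 2 (n/p - 1) times. The terms -1 cost 2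
    psi(n) <= 8n, the primes up to [N0] at most the subtracted sum. Two indices are needed because
    the density estimate holds at n, where the form may vanish; n! divides nu!, so the valuations
    carry over. *)
Lemma pade_form_lower n nu : (0 < n <= nu)%N -> form nu != 0 ->
  2 * n%:R * (\sum_(1 <= p < n.+1 | prime p) (B (p %% m)%N)%:R * ln (p%:R : R) / p%:R
     - \sum_(1 <= p < N0.+1 | prime p) ln (p%:R : R)) - 8 * n%:R
  <= ln `|form nu|%N%:R.
Proof.
move=> /andP[n0 nnu] f0; have F0 : (0 < `|form nu|)%N by rewrite absz_gt0.
have n0' : 0 < (n%:R : R) by rewrite ltr0n.
pose c p : R := (B (p %% m)%N && (N0 < p)%N)%:R.
apply: (@le_trans _ _ (\sum_(1 <= p < n.+1 | prime p) 2 * (n%:R / p%:R - 1) * c p * ln (p%:R : R))).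
  have -> : \sum_(1 <= p < n.+1 | prime p) 2 * (n%:R / p%:R - 1) * c p * ln (p%:R : R) =
    2 * n%:R * (\sum_(1 <= p < n.+1 | prime p) c p * ln (p%:R : R) / p%:R) -
    2 * \sum_(1 <= p < n.+1 | prime p) c p * ln (p%:R : R).
    by rewrite !mulr_sumr -sumrB; apply: eq_bigr => p _; ring.
  apply: lerD.
    rewrite ler_pM2l ?mulr_gt0 // lerBlDr.
    apply: (@le_trans _ _ (\sum_(1 <= p < n.+1 | prime p)
      (c p * ln (p%:R : R) / p%:R + (p <= N0)%:R * ln (p%:R : R)))).
      rewrite big_nat_cond [leRHS]big_nat_cond; apply: ler_sum => p /andP[/andP[p1 _] pp].
      rewrite /c; have l0 := @lnn_ge0 R p.
      have lp : ln (p%:R : R) / p%:R <= ln p%:R.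
        by rewrite ler_piMr // invf_le1 ?ltr0n // ler1n.
      have lp0 : 0 <= ln (p%:R : R) / p%:R by rewrite divr_ge0.
      by case: (B _); case: (leqP p N0) => _; rewrite /= ?mul0r ?mul1r ?add0r ?addr0.
    rewrite big_split lerD2l /=.
    have [nN|Nn] := leqP n N0.
      rewrite (big_nat_widen _ n.+1 N0.+1) // big_mkcond [leRHS]big_mkcond.
      apply: ler_sum => p _; case: (prime p) => //=; case: ifP => _; rewrite ?lnn_ge0 //.
      by rewrite ler_piMl ?lnn_ge0 // lern1 leq_b1.
    rewrite [leRHS](big_nat_widen _ N0.+1 n.+1); last by lia.
    rewrite big_mkcond [leRHS]big_mkcond; apply: ler_sum => p _.
    by case: (prime p) => //=; rewrite ltnS; case: leqP => _; rewrite ?mul1r ?mul0r.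
  rewrite lerN2 (_ : 8 * n%:R = 2 * (4 * n%:R)); last by ring.
  rewrite ler_pM2l //; apply: le_trans (chebyshev_psi_le R n).
  rewrite big_mkcond; apply: ler_sum => p _; case: ifP => [pp|_]; last exact: vonMangoldt_ge0.
  rewrite vonMangoldt_prime // ler_piMl ?lnn_ge0 // /c lern1 leq_b1 //.
rewrite ln_logn //.
have -> : \sum_(1 <= p < `|form nu|.+1 | prime p) (logn p `|form nu|)%:R * ln (p%:R : R) =
  \sum_(1 <= p < (maxn n `|form nu|).+1 | prime p) (logn p `|form nu|)%:R * ln (p%:R : R).
  rewrite big_mkcond [RHS]big_mkcond; apply: sum_nat_extend; first exact: leq_maxr.
  move=> p hp; case: ifP => // pp; rewrite lognE.
  case: ifP => [/and3P[_ _ /(dvdn_leq F0)]|_]; last by rewrite mul0r.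
  by rewrite leqNgt hp.
rewrite [leRHS](big_cat_nat _ (n := n.+1)) //=; last by rewrite ltnS leq_maxl.
rewrite -[leLHS]addr0; apply: lerD; last first.
  by apply: sumr_ge0 => p _; rewrite mulr_ge0 ?lnn_ge0.
rewrite big_nat_cond [leRHS]big_nat_cond; apply: ler_sum => p /andP[/andP[p0 pn] pp].
rewrite ler_wpM2r ?lnn_ge0 // /c.
have [/andP[Bp Np]|_] := boolP (_ && _); last by rewrite mulr0.
rewrite mulr1.
have dv : (p ^ (2 * logn p nu`!) %| `|form nu|)%N.
  have := @pade_euler_dvd p xi pp a b nu b0 (FB pp Bp Np).
  by rewrite dvdzE.
have : (2 * logn p n`! <= logn p `|form nu|)%N.
  rewrite -pfactor_dvdn //; apply: dvdn_trans dv; rewrite dvdn_exp2l // leq_mul2l /=.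
  by apply: dvdn_leq_log => //; [exact: fact_gt0 | exact: fact_dvd].
have : (n %/ p <= logn p n`!)%N.
  by rewrite logn_fact // big_ltn // expn1 leq_addr.
have : n%:R / p%:R - 1 <= (n %/ p)%N%:R :> R.
  rewrite lerBlDr ler_pdivrMr ?ltr0n // -(natrD _ _ 1) -natrM ler_nat addn1.
  by rewrite ltnW // ltn_ceil.
move=> h1 h2 h3; have h4 : (2 * (n %/ p) <= logn p `|form nu|)%N by lia.
by move: h4; rewrite -(ler_nat R) natrM; lra.
Qed.

Lemma prime_density_contradiction : (1 < m)%N -> (forall h, B h -> coprime h m) ->
  (totient m < 2 * \sum_(0 <= h < m) B h)%N -> False.
Proof.
move=> m1 Bc Bm.
have phi0 : 0 < ((totient m)%:R : R) by rewrite ltr0n totient_gt0 ltnW.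
set d : R := (4 * (totient m)%:R)^-1; have d0 : 0 < d by rewrite invr_gt0 mulr_gt0.
pose K : R := \sum_(1 <= p < N0.+1 | prime p) ln (p%:R : R).
pose c1 : R := ln (`|a| + `|b|)%N%:R; pose c2 : R := ln (4 * `|xi|)%N%:R.
have c10 : 0 <= c1 by exact: lnn_ge0.
have c20 : 0 <= c2 by exact: lnn_ge0.
(* The numerator collects the coefficients of n: 2 [c2] since nu <= 2n, 1 from ln (n+1)! <= n ln n +
   n, 4 from the loss of 2 in [prime_log_density] doubled, and 2 [K] + 8 from [pade_form_lower]. *)
pose X := (c1 + 2 * c2 + 1 + 4 + 2 * K + 8) / (2 * d).
have [n nX hn] := @prime_log_density R m B (Num.truncn (expR X)).+1 m1 Bc Bm.
have n0 : (0 < n)%N by apply: leq_trans nX.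
have n0' : 0 < (n%:R : R) by rewrite ltr0n.
have lX : X < ln n%:R.
  rewrite -[X]expRK ltr_ln ?posrE ?expR_gt0 //.
  by apply: lt_le_trans (truncnS_gt _) _; rewrite ler_nat.
have [nu [nnu nun f0]] : exists nu, [/\ (n <= nu)%N, (nu <= n.+1)%N & form nu != 0].
  by case/orP: (pade_form_neq0 n) => f0; [exists n | exists n.+1].
have up := pade_form_upper f0.
have lo := @pade_form_lower n nu _ f0; rewrite n0 nnu in lo; move: {lo}(lo isT) => lo.
have nu1 : ln (nu`!%:R : R) <= n%:R * ln n%:R + n%:R.
  apply: (@le_trans _ _ (ln (n.+1)`!%:R)).
    by rewrite ler_ln ?posrE ?ltr0n ?fact_gt0 // ler_nat dvdn_leq ?fact_gt0 // fact_dvd.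
  rewrite factS natrM lnM ?posrE ?ltr0n ?fact_gt0 // addrC; apply: lerD; first exact: ln_fact_le.
  by have := @ln_le_subr1 R n.+1%:R; rewrite ltr0n => /(_ isT); rewrite -[n.+1]addn1 natrD; lra.
have nu2 : (nu%:R : R) <= 2 * n%:R.
  by rewrite -natrM ler_nat; lia.
have n1 : 1 <= (n%:R : R) by rewrite ler1n.
have h1 : nu%:R * c2 <= 2 * n%:R * c2 by apply: ler_wpM2r.
have h2 : c1 <= n%:R * c1 by rewrite ler_peMl.
have lo2 : 2 * n%:R * ((2^-1 + d) * ln n%:R - 2 - K) - 8 * n%:R <= ln (`|form nu|%N%:R : R).
  by apply: le_trans lo; rewrite lerD2r ler_pM2l ?mulr_gt0 // lerD2r.
have key : 2 * d * ln n%:R <= c1 + 2 * c2 + 1 + 4 + 2 * K + 8.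
  rewrite -(ler_pM2l n0'); rewrite -/c1 -/c2 in up; lra.
move: lX; rewrite /X ltr_pdivrMr ?mulr_gt0 // mulrC; lra.
Qed.

End Contradiction.

(** * From the contradiction to the residue classes *)

Lemma finite_nat_bounded (A : set nat) : finite_set A ->
  exists N, forall p, A p -> (p <= N)%N.
Proof.
move=> /finite_seqP[s ->]; exists (\max_(i <- s) i)%N => p /= ps.
exact: (@leq_bigmax_seq _ s xpredT id p).
Qed.

Lemma residue_class_nat m p : residue_class m (p %% m)%N%:Z p%:Z.
Proof. by exists (p %/ m)%N%:Z => //; rewrite -PoszM -PoszD addnC -divn_eq. Qed.

Lemma residue_class_inj m h k : (h < m)%N -> (k < m)%N ->
  residue_class m h%:Z = residue_class m k%:Z -> h = k.
Proof.
move=> hm km hk; have : residue_class m k%:Z h%:Z by rewrite -hk; exists 0 => //;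
  rewrite mul0r addr0.
case=> j _ /= jE; have : (k%:Z + j * m%:Z = h%:Z)%R by [].
have m0 : 0 < m%:Z by lia.
move=> E; have j0 : j = 0 by nia.
by move: E; rewrite j0 mul0r addr0 => -[].
Qed.

Theorem corollary4 (xi a b : int) (m : nat)
    (xi_neq0 : xi <> 0) (b_neq0 : b <> 0) (m_ge3 : (3 <= m)%N) :
  exists S : set (set int),
    (S #= `I_(totient m %/ 2))%card /\
    forall C : set int, S C ->
      reduced_residue_class m C /\
      infinite_set [set p : nat | prime p /\ C p%:Z /\
        euler_series (xi%:~R : Qp p) <> a%:~R / b%:~R].
Proof.
have m1 : (1 < m)%N by lia.
pose I h := [set p : nat | prime p /\ residue_class m h%:Z p%:Z /\
        euler_series (xi%:~R : Qp p) <> a%:~R / b%:~R].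
pose good h := coprime h m && `[< infinite_set (I h) >].
pose gs := [seq h <- iota 0 m | good h].
have gs_size : (totient m %/ 2 <= size gs)%N.
  rewrite leqNgt; apply/negP => small.
  pose B h := coprime h m && ~~ `[< infinite_set (I h) >].
  have bounded h : exists N, B h -> forall p, I h p -> (p <= N)%N.
    case: (boolP (B h)) => [|_]; last by exists 0%N.
    case/andP => _ /asboolPn /contrapT /finite_nat_bounded[N HN].
    by exists N.
  have [N HN] := choice bounded.
  (* One threshold for all bad classes: the sum of the finitely many individual bounds dominates
     each of them. *)
  pose N0 := (\sum_(0 <= h < m) N h)%N.
  apply: (@prime_density_contradiction Rdefinitions.R xi a b m N0 B) => //; try exact/eqP.
  - move=> p pp Bp Np; apply: contrapT => ne.
    have Ip : I (p %% m)%N p by split => //; split => //; exact: residue_class_nat.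
    have := HN _ Bp p Ip.
    have : (N (p %% m) <= N0)%N.
      rewrite /N0 (bigD1_seq (p %% m)%N) ?leq_addr ?iota_uniq ?mem_index_iota ?ltn_pmod //.
      exact: ltnW.
    lia.
  - by move=> h /andP[].
  - have : (\sum_(0 <= h < m) B h + size gs = totient m)%N.
      rewrite totient_count_coprime size_filter -sum1_count [X in (_ + X)%N]big_mkcond /=.
      rewrite /index_iota subn0.
      rewrite -big_split /=; apply: eq_bigr => h _.
      by rewrite /B /good [coprime m h]coprime_sym; case: coprime; case: asbool.
    lia.
pose k := (totient m %/ 2)%N.
pose g i := nth 0%N gs i.
have gP i : (i < k)%N -> good (g i) /\ (g i < m)%N.
  move=> ik; have : g i \in gs by apply: mem_nth; apply: leq_trans gs_size.
  by rewrite mem_filter mem_iota add0n => /andP[].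
exists ((fun i => residue_class m (g i)%:Z) @` `I_k); split.
  apply: inj_card_eq => i j; rewrite !inE /= => ik jk /residue_class_inj.
  have [_ im] := gP _ ik; have [_ jm] := gP _ jk.
  move=> /(_ im jm) /eqP; rewrite nth_uniq ?filter_uniq ?iota_uniq //.
  - by move/eqP.
  - exact: leq_trans gs_size.
  - exact: leq_trans gs_size.
move=> _ [i /= ik <-]; have [/andP[gc /asboolP gi] gm] := gP _ ik.
by split=> //; exists (g i)%:Z => //; rewrite /coprimez /gcdz /= -/(coprime _ _).
Qed.
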